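(* The synchronous subtyping relation $\le_s$ is sound for the synchronous session calculus: for all closed session types $T,S$ with $T\le_s S$, there do not exist an evaluation context $C$ and a process $P$ such that $\vdash_s C[a:S]\triangleright\emptyset$, $\vdash_s P\triangleright\{a:T\}$ and $C[P]\to_s^*\mathtt{error}$.
   Context: Synchronous session calculus. There are countable sets of channel variables $x,y,z,\ldots$, linear channels $a,b,c,d,\ldots$, labels $l,l_i,\ldots$ and process variables $X,Y,\ldots$; identifiers are $u ::= a \mid x$. Processes are $P ::= \mathbf 0 \mid X\langle\tilde u\rangle \mid \sum_{i\in I} u?l_i(x_i).P_i \mid u!l\langle u'\rangle.P \mid P\,|\,P \mid P\oplus P \mid \mathbf{def}\ X(\tilde x)=P\ \mathbf{in}\ P \mid (\nu ab)P \mid \mathtt{error}$, where in an input the labels $l_i$ are pairwise distinct, and recursion is guarded (in a declaration $D$ of the form $X(\tilde x)=P$, process variables occur in $P$ only under an input or output prefix). Binders: $x_i$ in inputs, $\tilde x$ and $X$ in definitions, and $a,b$ in $(\nu ab)P$ (which makes $a,b$ co-channels); processes are considered up to $\alpha$-conversion, bound names distinct from free ones. $\mathrm{fc}(P)$ is the set of free linear channels of $P$; the free subject channels are $\mathrm{sc}(u!l\langle u'\rangle.P)=\mathrm{fc}(u)\cup\mathrm{sc}(P)$, $\mathrm{sc}(\sum_i u?l_i(x_i).P_i)=\mathrm{fc}(u)\cup\bigcup_i\mathrm{sc}(P_i)$, $\mathrm{sc}(\mathbf{def}\ D\ \mathbf{in}\ P)=\mathrm{sc}(P)$, where $\mathrm{fc}(x)=\emptyset$,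 $\mathrm{fc}(a)=\{a\}$, and $\mathrm{sc}$ is defined structurally on the other constructors (union over components of $|$ and $\oplus$, removing $a,b$ under $(\nu ab)$, empty for $\mathbf 0$, process calls and $\mathtt{error}$). Structural congruence $\equiv$ is the least congruence with: $\mathbf 0|P\equiv P$; $|$ and $\oplus$ commutative and associative; $(\nu ab)\mathbf 0\equiv\mathbf 0$; $((\nu ab)P)|Q\equiv(\nu ab)(P|Q)$; $(\nu ab)(\nu cd)P\equiv(\nu cd)(\nu ab)P$; $\mathbf{def}\ D\ \mathbf{in}\ \mathbf 0\equiv\mathbf 0$; $\mathbf{def}\ D\ \mathbf{in}\ (\nu ab)P\equiv(\nu ab)(\mathbf{def}\ D\ \mathbf{in}\ P)$; $(\mathbf{def}\ D\ \mathbf{in}\ P)|Q\equiv\mathbf{def}\ D\ \mathbf{in}\ (P|Q)$; $\mathbf{def}\ D\ \mathbf{in}\ \mathbf{def}\ D'\ \mathbf{in}\ P\equiv\mathbf{def}\ D'\ \mathbf{in}\ \mathbf{def}\ D\ \mathbf{in}\ P$. Evaluation contexts: $C ::= [\,] \mid C|P \mid (\nu ab)C \mid \mathbf{def}\ D\ \mathbf{in}\ C$. The reduction $\to_s$ is the least relation closed under: $(\nu ab)(a!l_k\langle c\rangle.P \mid \sum_{i\in I} b?l_i(x_i).Q_i)\to(\nu ab)(P\mid Q_k\{c/x_k\})$ if $k\in I$; $\mathbf{def}\ X(\tilde x)=P\ \mathbf{in}\ (X\langle\tilde a\rangle\mid Q)\to\mathbf{def}\ X(\tilde x)=P\ \mathbf{in}\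 (P\{\tilde a/\tilde x\}\mid Q)$; $P\oplus Q\to P$; $P\to P'$ implies $C[P]\to C[P']$; $P\equiv P'\to Q'\equiv Q$ implies $P\to Q$; and the error rules: $(\nu ab)(a!l\langle c\rangle.P\mid\sum_{i\in I}b?l_i(x_i).Q_i)\to\mathtt{error}$ if $l\neq l_i$ for all $i\in I$; $(\nu ab)P\to\mathtt{error}$ if $a\in\mathrm{sc}(P)$ and $b\notin\mathrm{fc}(P)$; $(\nu ab)(a!l\langle c\rangle.P\mid b!l'\langle c'\rangle.Q)\to\mathtt{error}$; $(\nu ab)(\sum_{i\in I}a?l_i(x_i).P_i\mid\sum_{j\in J}b?l'_j(x'_j).Q_j)\to\mathtt{error}$; $C[\mathtt{error}]\to\mathtt{error}$. $\to_s^*$ is its reflexive-transitive closure. Session types: $T,S ::= \&_{i\in I}?l_i(S_i).T_i \mid \bigoplus_{i\in I}!l_i\langle S_i\rangle.T_i \mid \mathbf t \mid \mu\mathbf t.T \mid \mathsf{end}$, with pairwise distinct labels in each branching/selection, closed exchanged types $S_i$ and contractive recursion; types are equi-recursive (identified when they have the same regular tree, so $\mu\mathbf t.T=T\{\mu\mathbf t.T/\mathbf t\}$). Duality $\overline T$: $\overline{\&_i ?l_i(S_i).T_i}=\bigoplus_i!l_i\langle S_i\rangle.\overline{T_i}$, $\overline{\bigoplus_i!l_i\langle S_i\rangle.T_i}=\&_i?l_i(S_i).\overline{T_i}$, $\overline{\mathbf t}=\mathbf t$, $\overline{\mu\mathbf t.T}=\mu\mathbf t.\overline T$, $\overline{\mathsf{end}}=\mathsf{end}$.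 Synchronous subtyping $\le_s$ is the largest relation on closed types such that $T\le_s S$ implies one of: $T=S=\mathsf{end}$; $T=\&_{i\in I\cup J}?l_i(S_i).T_i$, $S=\&_{i\in I}?l_i(S'_i).T'_i$ with $S_i\le_s S'_i$ and $T_i\le_s T'_i$ for all $i\in I$; $T=\bigoplus_{i\in I}!l_i\langle S_i\rangle.T_i$, $S=\bigoplus_{i\in I\cup J}!l_i\langle S'_i\rangle.T'_i$ with $S'_i\le_s S_i$ and $T_i\le_s T'_i$ for all $i\in I$. Typing: shared environments $\Gamma ::= \emptyset\mid\Gamma,X:\tilde T$; session environments $\Delta ::= \emptyset\mid\Delta,u:T$ ($\Delta_1,\Delta_2$ denotes union of environments with disjoint domains). $\Delta_1\le_s\Delta_2$ means $\Delta_1(u)\le_s\Delta_2(u)$ for $u$ in both domains and $\Delta_i(u)=\mathsf{end}$ for $u$ in only one domain. $\Gamma\vdash_s P\triangleright\Delta$ is derived by: from $\Gamma\vdash_s P\triangleright\Delta$ and $\Delta\le_s\Delta'$ infer $\Gamma\vdash_s P\triangleright\Delta'$; $\Gamma\vdash_s\mathbf 0\triangleright\emptyset$; $\Gamma,X:\tilde T\vdash_s X\langle\tilde u\rangle\triangleright\{\tilde u:\tilde T\}$; if $\Gamma\vdash_s P_i\triangleright\Delta,u:T_i,x_i:S_i$ for all $i\in I$ then $\Gamma\vdash_s\sum_{i\in I}u?l_i(x_i).P_i\triangleright\Delta,u:\&_{i\in I}?l_i(S_i).T_i$; if $\Gamma\vdash_s P\triangleright\Delta,u:T$ then $\Gamma\vdash_s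 u!l\langle u'\rangle.P\triangleright\Delta,u:!l\langle S\rangle.T,u':S$; if $\Gamma\vdash_s P_1\triangleright\Delta_1$ and $\Gamma\vdash_s P_2\triangleright\Delta_2$ then $\Gamma\vdash_s P_1|P_2\triangleright\Delta_1,\Delta_2$; if $\Gamma\vdash_s P_1\triangleright\Delta$ and $\Gamma\vdash_s P_2\triangleright\Delta$ then $\Gamma\vdash_s P_1\oplus P_2\triangleright\Delta$; if $\Gamma,X:\tilde T\vdash_s P\triangleright\{\tilde x:\tilde T\}$ and $\Gamma,X:\tilde T\vdash_s Q\triangleright\Delta$ then $\Gamma\vdash_s\mathbf{def}\ X(\tilde x)=P\ \mathbf{in}\ Q\triangleright\Delta$; if $\Gamma\vdash_s P\triangleright\Delta,a:T,b:\overline T$ then $\Gamma\vdash_s(\nu ab)P\triangleright\Delta$. No rule types $\mathtt{error}$. $\vdash_s P\triangleright\Delta$ means $\emptyset\vdash_s P\triangleright\Delta$. For an evaluation context $C$, $\vdash_s C[a:S]\triangleright\emptyset$ means $X:S\vdash_s C[X\langle a\rangle]\triangleright\emptyset$ for a process variable $X$ not occurring in $C$.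
   Formalization: Input sums in processes are required to have a nonempty index set I; with an empty sum the input typing rule has no premise and types it with any session environment, so a typable process such as (νef) of an empty input on e reduces to error. *)

(* Defs.v *)
From HB Require Import structures.
From mathcomp Require Import all_boot finmap.
From Stdlib Require Export Relation_Operators.

Set Implicit Arguments.
Unset Strict Implicit.
Unset Printing Implicit Defensive.

Local Open Scope fset_scope.
Local Open Scope fmap_scope.

(* The countable sets of names. *)
Notation label := nat (only parsing).
Notation chan := nat (only parsing).
Notation cvar := nat (only parsing).
Notation pvar := nat (only parsing).
Notation tvar := nat (only parsing).

(* A family indexed by pairwise distinct labels is a list of pairs; families
   are only inspected through [lookup] and their set of labels, so the order
   of the list is irrelevant. *)
Fixpoint lookup (A : Type) (l : label) (bs : seq (label * A)) : option A :=
  if bs is (k, b) :: bs' then if k == l then Some b else lookup l bs' else None.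

(** * Session types *)

(* [TBra [:: (l, (S, T)); ...]] is the branching with branches ?l(S).T, and
   [TSel [:: (l, (S, T)); ...]] the selection with branches !l<S>.T. *)
Inductive typ : Type :=
| TEnd
| TVar of tvar
| TMu of tvar & typ
| TBra of seq (label * (typ * typ))
| TSel of seq (label * (typ * typ)).

Fixpoint ftv (T : typ) : seq tvar :=
  match T with
  | TEnd => [::]
  | TVar t => [:: t]
  | TMu t T => [seq s <- ftv T | s != t]
  | TBra bs | TSel bs => flatten [seq ftv b.2.1 ++ ftv b.2.2 | b <- bs]
  end.

Definition closed_typ (T : typ) : bool := nilp (ftv T).

Fixpoint unguarded (t : tvar) (T : typ) : bool :=
  match T with
  | TVar s => s == t
  | TMu s T => (s != t) && unguarded t T
  | _ => false
  end.

(* Distinct labels, closed exchanged types, contractive recursion. *)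
Fixpoint wf_typ (T : typ) : bool :=
  match T with
  | TEnd | TVar _ => true
  | TMu t T => ~~ unguarded t T && wf_typ T
  | TBra bs | TSel bs =>
      uniq (unzip1 bs) &&
      all (fun b => [&& closed_typ b.2.1, wf_typ b.2.1 & wf_typ b.2.2]) bs
  end.

Definition stype (T : typ) : bool := closed_typ T && wf_typ T.

(* No capture can occur when [U] is closed, which is the only case needed to
   unfold closed types. *)
Fixpoint tsubst (t : tvar) (U T : typ) : typ :=
  match T with
  | TEnd => TEnd
  | TVar s => if s == t then U else TVar s
  | TMu s T => if s == t then TMu s T else TMu s (tsubst t U T)
  | TBra bs => TBra [seq (b.1, (tsubst t U b.2.1, tsubst t U b.2.2)) | b <- bs]
  | TSel bs => TSel [seq (b.1, (tsubst t U b.2.1, tsubst t U b.2.2)) | b <- bs]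
  end.

Fixpoint dual (T : typ) : typ :=
  match T with
  | TEnd => TEnd
  | TVar t => TVar t
  | TMu t T => TMu t (dual T)
  | TBra bs => TSel [seq (b.1, (b.2.1, dual b.2.2)) | b <- bs]
  | TSel bs => TBra [seq (b.1, (b.2.1, dual b.2.2)) | b <- bs]
  end.

Inductive unfolds : typ -> typ -> Prop :=
| unfolds_refl T : unfolds T T
| unfolds_mu t T S : unfolds (tsubst t (TMu t T) T) S -> unfolds (TMu t T) S.

(* [tree_eq T S]: the infinite unfoldings of T and S are the same tree. *)
CoInductive tree_eq : typ -> typ -> Prop :=
| tree_eq_end T S : unfolds T TEnd -> unfolds S TEnd -> tree_eq T S
| tree_eq_bra T S bs cs :
    unfolds T (TBra bs) -> unfolds S (TBra cs) -> unzip1 bs =i unzip1 cs ->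
    (forall l T1 T2 S1 S2,
       lookup l bs = Some (T1, T2) -> lookup l cs = Some (S1, S2) ->
       tree_eq T1 S1 /\ tree_eq T2 S2) ->
    tree_eq T S
| tree_eq_sel T S bs cs :
    unfolds T (TSel bs) -> unfolds S (TSel cs) -> unzip1 bs =i unzip1 cs ->
    (forall l T1 T2 S1 S2,
       lookup l bs = Some (T1, T2) -> lookup l cs = Some (S1, S2) ->
       tree_eq T1 S1 /\ tree_eq T2 S2) ->
    tree_eq T S.

(* Types are equi-recursive, hence the equalities of types in the clauses are
   [tree_eq]. *)
CoInductive subtype : typ -> typ -> Prop :=
| sub_end T S :
    stype T -> stype S -> tree_eq T TEnd -> tree_eq S TEnd -> subtype T S
| sub_bra T S bs cs :
    stype T -> stype S -> tree_eq T (TBra bs) -> tree_eq S (TBra cs) ->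
    (forall l S1 S2, lookup l cs = Some (S1, S2) ->
       exists T1 T2,
         [/\ lookup l bs = Some (T1, T2), subtype T1 S1 & subtype T2 S2]) ->
    subtype T S
| sub_sel T S bs cs :
    stype T -> stype S -> tree_eq T (TSel bs) -> tree_eq S (TSel cs) ->
    (forall l T1 T2, lookup l bs = Some (T1, T2) ->
       exists S1 S2,
         [/\ lookup l cs = Some (S1, S2), subtype S1 T1 & subtype T2 S2]) ->
    subtype T S.

(** * Processes *)

Inductive ident : Type := Chan of chan | Var of cvar.

Definition sum_of_ident (u : ident) : nat + nat :=
  match u with Chan a => inl a | Var x => inr x end.
Definition ident_of_sum (s : nat + nat) : ident :=
  match s with inl a => Chan a | inr x => Var x end.
Lemma sum_of_identK : cancel sum_of_ident ident_of_sum.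
Proof. by case. Qed.
HB.instance Definition _ := Countable.copy ident (can_type sum_of_identK).

(* Raw named terms: [Inp u [:: (l, (x, P)); ...]] is the input with branches
   u?l(x).P, [Def X xs P Q] is def X(xs) = P in Q, and [Res a b P] is (nu ab)P.
   Processes are the raw terms satisfying [is_proc] below, taken up to the
   relation [alpha]. *)
Inductive proc : Type :=
| Nil
| Call of pvar & seq ident
| Inp of ident & seq (label * (cvar * proc))
| Out of ident & label & ident & proc
| Par of proc & proc
| Plus of proc & proc
| Def of pvar & seq cvar & proc & proc
| Res of chan & chan & proc
| Err.

Fixpoint guarded (P : proc) : bool :=
  match P with
  | Call _ _ => false
  | Nil | Err | Inp _ _ | Out _ _ _ _ => true
  | Par P Q | Plus P Q | Def _ _ P Q => guarded P && guarded Q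
  | Res _ _ P => guarded P
  end.

(* Sums are nonempty: the typing rule of an empty sum would have no premise and
   accept any session environment, which breaks linearity. *)
Fixpoint is_proc (P : proc) : bool :=
  match P with
  | Nil | Call _ _ | Err => true
  | Inp _ bs =>
      [&& 0 < size bs, uniq (unzip1 bs) & all (fun b => is_proc b.2.2) bs]
  | Out _ _ _ P => is_proc P
  | Par P Q | Plus P Q => is_proc P && is_proc Q
  | Def _ xs P Q => [&& uniq xs, guarded P, is_proc P & is_proc Q]
  | Res a b P => (a != b) && is_proc P
  end.

Definition ichan (u : ident) : seq chan := if u is Chan a then [:: a] else [::].

Fixpoint fc (P : proc) : seq chan :=
  match P with
  | Nil | Err => [::]
  | Call _ us => flatten (map ichan us)
  | Inp u bs => ichan u ++ flatten [seq fc b.2.2 | b <- bs]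
  | Out u _ v P => ichan u ++ ichan v ++ fc P
  | Par P Q | Plus P Q | Def _ _ P Q => fc P ++ fc Q
  | Res a b P => [seq c <- fc P | c \notin [:: a; b]]
  end.

Fixpoint sc (P : proc) : seq chan :=
  match P with
  | Nil | Err | Call _ _ => [::]
  | Inp u bs => ichan u ++ flatten [seq sc b.2.2 | b <- bs]
  | Out u _ _ P => ichan u ++ sc P
  | Par P Q | Plus P Q => sc P ++ sc Q
  | Def _ _ _ Q => sc Q
  | Res a b P => [seq c <- sc P | c \notin [:: a; b]]
  end.

(* Bound channels. *)
Fixpoint bc (P : proc) : seq chan :=
  match P with
  | Nil | Err | Call _ _ => [::]
  | Inp _ bs => flatten [seq bc b.2.2 | b <- bs]
  | Out _ _ _ P => bc P
  | Par P Q | Plus P Q | Def _ _ P Q => bc P ++ bc Q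
  | Res a b P => [:: a, b & bc P]
  end.

(* All identifiers of a raw term, free, bound or binding. *)
Fixpoint ids (P : proc) : seq ident :=
  match P with
  | Nil | Err => [::]
  | Call _ us => us
  | Inp u bs => u :: flatten [seq Var b.2.1 :: ids b.2.2 | b <- bs]
  | Out u _ v P => [:: u, v & ids P]
  | Par P Q | Plus P Q => ids P ++ ids Q
  | Def _ xs P Q => map Var xs ++ ids P ++ ids Q
  | Res a b P => [:: Chan a, Chan b & ids P]
  end.

(* Free process variables. *)
Fixpoint fpv (P : proc) : seq pvar :=
  match P with
  | Nil | Err => [::]
  | Call X _ => [:: X]
  | Inp _ bs => flatten [seq fpv b.2.2 | b <- bs]
  | Out _ _ _ P | Res _ _ P => fpv P
  | Par P Q | Plus P Q => fpv P ++ fpv Q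
  | Def X _ P Q => [seq Y <- fpv P ++ fpv Q | Y != X]
  end.

(* All process variables of a raw term, free, bound or binding. *)
Fixpoint pvs (P : proc) : seq pvar :=
  match P with
  | Nil | Err => [::]
  | Call X _ => [:: X]
  | Inp _ bs => flatten [seq pvs b.2.2 | b <- bs]
  | Out _ _ _ P | Res _ _ P => pvs P
  | Par P Q | Plus P Q => pvs P ++ pvs Q
  | Def X _ P Q => X :: pvs P ++ pvs Q
  end.

Definition mask (us : seq ident) (s : ident -> ident) (u : ident) : ident :=
  if u \in us then u else s u.

(* Simultaneous replacement of the free identifiers of a raw term. It does not
   rename binders; each use below comes with a condition excluding capture. *)
Fixpoint subst (s : ident -> ident) (P : proc) : proc :=
  match P with
  | Nil => Nil
  | Err => Err
  | Call X us => Call X (map s us)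
  | Inp u bs =>
      Inp (s u) [seq (b.1, (b.2.1, subst (mask [:: Var b.2.1] s) b.2.2)) | b <- bs]
  | Out u l v P => Out (s u) l (s v) (subst s P)
  | Par P Q => Par (subst s P) (subst s Q)
  | Plus P Q => Plus (subst s P) (subst s Q)
  | Def X xs P Q => Def X xs (subst (mask (map Var xs) s) P) (subst s Q)
  | Res a b P => Res a b (subst (mask [:: Chan a; Chan b] s) P)
  end.

(* Maps the i-th element of [us] to the i-th element of [vs] (lists of the same
   length) and every other identifier to itself. *)
Definition repl (us vs : seq ident) (u : ident) : ident := nth u vs (index u us).

Fixpoint prename (X Y : pvar) (P : proc) : proc :=
  match P with
  | Nil => Nil
  | Err => Err
  | Call Z us => Call (if Z == X then Y else Z) us
  | Inp u bs => Inp u [seq (b.1, (b.2.1, prename X Y b.2.2)) | b <- bs]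
  | Out u l v P => Out u l v (prename X Y P)
  | Par P Q => Par (prename X Y P) (prename X Y Q)
  | Plus P Q => Plus (prename X Y P) (prename X Y Q)
  | Def Z xs P Q =>
      if Z == X then Def Z xs P Q
      else Def Z xs (prename X Y P) (prename X Y Q)
  | Res a b P => Res a b (prename X Y P)
  end.

(* The least congruence containing [R]. *)
Inductive congruence (R : proc -> proc -> Prop) : proc -> proc -> Prop :=
| cg_base P Q : R P Q -> congruence R P Q
| cg_refl P : congruence R P P
| cg_sym P Q : congruence R P Q -> congruence R Q P
| cg_trans P Q O : congruence R P Q -> congruence R Q O -> congruence R P O
| cg_inp u bs l x P Q cs :
    congruence R P Q ->
    congruence R (Inp u (bs ++ (l, (x, P)) :: cs)) (Inp u (bs ++ (l, (x, Q)) :: cs))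
| cg_out u l v P Q : congruence R P Q -> congruence R (Out u l v P) (Out u l v Q)
| cg_par P P' Q Q' :
    congruence R P P' -> congruence R Q Q' -> congruence R (Par P Q) (Par P' Q')
| cg_plus P P' Q Q' :
    congruence R P P' -> congruence R Q Q' -> congruence R (Plus P Q) (Plus P' Q')
| cg_def X xs P P' Q Q' :
    congruence R P P' -> congruence R Q Q' ->
    congruence R (Def X xs P Q) (Def X xs P' Q')
| cg_res a b P Q : congruence R P Q -> congruence R (Res a b P) (Res a b Q).

(* Renaming of one binder to a name that occurs nowhere in its scope. *)
Inductive alpha_ax : proc -> proc -> Prop :=
| alpha_inp u bs l x y P cs :
    Var y \notin ids P ->
    alpha_ax (Inp u (bs ++ (l, (x, P)) :: cs))
             (Inp u (bs ++ (l, (y, subst (repl [:: Var x] [:: Var y]) P)) :: cs))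
| alpha_param X xs x y ys P Q :
    x \notin xs ++ ys -> y \notin xs ++ ys -> Var y \notin ids P ->
    alpha_ax (Def X (xs ++ x :: ys) P Q)
             (Def X (xs ++ y :: ys) (subst (repl [:: Var x] [:: Var y]) P) Q)
| alpha_def X Y xs P Q :
    Y \notin pvs P -> Y \notin pvs Q ->
    alpha_ax (Def X xs P Q) (Def Y xs (prename X Y P) (prename X Y Q))
| alpha_resl a a' b P :
    a != b -> a' != b -> Chan a' \notin ids P ->
    alpha_ax (Res a b P) (Res a' b (subst (repl [:: Chan a] [:: Chan a']) P))
| alpha_resr a b b' P :
    a != b -> a != b' -> Chan b' \notin ids P ->
    alpha_ax (Res a b P) (Res a b' (subst (repl [:: Chan b] [:: Chan b']) P)).

Definition alpha : proc -> proc -> Prop := congruence alpha_ax.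

(* The side conditions spell out the convention that bound names are distinct
   from free ones. *)
Inductive scong_ax : proc -> proc -> Prop :=
| sc_nil P : scong_ax (Par Nil P) P
| sc_parC P Q : scong_ax (Par P Q) (Par Q P)
| sc_parA P Q O : scong_ax (Par P (Par Q O)) (Par (Par P Q) O)
| sc_plusC P Q : scong_ax (Plus P Q) (Plus Q P)
| sc_plusA P Q O : scong_ax (Plus P (Plus Q O)) (Plus (Plus P Q) O)
| sc_res_nil a b : scong_ax (Res a b Nil) Nil
| sc_res_par a b P Q :
    a \notin fc Q -> b \notin fc Q ->
    scong_ax (Par (Res a b P) Q) (Res a b (Par P Q))
| sc_res_res a b c d P :
    a \notin [:: c; d] -> b \notin [:: c; d] ->
    scong_ax (Res a b (Res c d P)) (Res c d (Res a b P))
| sc_def_nil X xs P : scong_ax (Def X xs P Nil) Nil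
| sc_def_res X xs P a b Q :
    a \notin fc P -> b \notin fc P ->
    scong_ax (Def X xs P (Res a b Q)) (Res a b (Def X xs P Q))
| sc_def_par X xs P Q O :
    X \notin fpv O ->
    scong_ax (Par (Def X xs P Q) O) (Def X xs P (Par Q O))
| sc_def_def X xs P Y ys Q O :
    X != Y -> X \notin fpv Q -> Y \notin fpv P ->
    scong_ax (Def X xs P (Def Y ys Q O)) (Def Y ys Q (Def X xs P O)).

(* Structural congruence of processes up to alpha-conversion. *)
Definition scong : proc -> proc -> Prop :=
  congruence (fun P Q => [/\ alpha_ax P Q \/ scong_ax P Q, is_proc P & is_proc Q]).

(** * Evaluation contexts and reduction *)

Inductive ectx : Type :=
| Hole
| CPar of ectx & proc
| CRes of chan & chan & ectx
| CDef of pvar & seq cvar & proc & ectx.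

(* Filling is meant to capture the names bound by the context. *)
Fixpoint fill (C : ectx) (P : proc) : proc :=
  match C with
  | Hole => P
  | CPar C Q => Par (fill C P) Q
  | CRes a b C => Res a b (fill C P)
  | CDef X xs Q C => Def X xs Q (fill C P)
  end.

Definition is_ectx (C : ectx) : bool := is_proc (fill C Nil).

Definition ectx_pvs (C : ectx) : seq pvar := pvs (fill C Nil).

Inductive red : proc -> proc -> Prop :=
| red_com a b l c P bs x Q :
    lookup l bs = Some (x, Q) -> c \notin bc Q ->
    red (Res a b (Par (Out (Chan a) l (Chan c) P) (Inp (Chan b) bs)))
        (Res a b (Par P (subst (repl [:: Var x] [:: Chan c]) Q)))
| red_call X xs P cs Q :
    size cs = size xs -> all (fun c => c \notin bc P) cs ->
    red (Def X xs P (Par (Call X (map Chan cs)) Q))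
        (Def X xs P (Par (subst (repl (map Var xs) (map Chan cs)) P) Q))
| red_plus P Q : red (Plus P Q) P
| red_ctx C P P' : red P P' -> red (fill C P) (fill C P')
| red_scong P P' Q' Q : scong P P' -> red P' Q' -> scong Q' Q -> red P Q
| red_err_label a b l c P bs :
    lookup l bs = None ->
    red (Res a b (Par (Out (Chan a) l (Chan c) P) (Inp (Chan b) bs))) Err
| red_err_lone a b P : a \in sc P -> b \notin fc P -> red (Res a b P) Err
| red_err_out a b l c P l' c' Q :
    red (Res a b (Par (Out (Chan a) l (Chan c) P) (Out (Chan b) l' (Chan c') Q))) Err
| red_err_inp a b bs cs :
    red (Res a b (Par (Inp (Chan a) bs) (Inp (Chan b) cs))) Err
| red_err_ctx C : red (fill C Err) Err.

Definition reds : proc -> proc -> Prop := clos_refl_trans proc red.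

(** * Typing *)

Definition shenv := {fmap pvar -> seq typ}.
Definition senv := {fmap ident -> typ}.

Definition wf_senv (D : senv) : Prop := forall u T, D.[? u] = Some T -> stype T.

(* The environment written [us : Ts], for distinct identifiers [us]. *)
Definition senv_of (us : seq ident) (Ts : seq typ) : senv :=
  foldr (fun p (D : senv) => D.[p.1 <- p.2]) fmap0 (zip us Ts).

Definition senv_sub (D1 D2 : senv) : Prop :=
  forall u,
    match D1.[? u], D2.[? u] with
    | Some T1, Some T2 => subtype T1 T2
    | Some T, None | None, Some T => tree_eq T TEnd
    | None, None => True
    end.

Definition senv_eq (D1 D2 : senv) : Prop :=
  forall u,
    match D1.[? u], D2.[? u] with
    | Some T1, Some T2 => tree_eq T1 T2
    | None, None => True
    | _, _ => False
    end.

(* In "D, u : T" the identifier u is not in the domain of D. The rules [ty_eq]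
   and [ty_alpha] express that types are identified when they have the same
   tree and processes when they are alpha-convertible. *)
Inductive typing : shenv -> proc -> senv -> Prop :=
| ty_sub (G : shenv) P (D D' : senv) :
    typing G P D -> senv_sub D D' -> wf_senv D' -> typing G P D'
| ty_eq (G : shenv) P (D D' : senv) :
    typing G P D -> senv_eq D D' -> wf_senv D' -> typing G P D'
| ty_alpha (G : shenv) P P' (D : senv) :
    typing G P D -> alpha P P' -> typing G P' D
| ty_nil (G : shenv) : typing G Nil fmap0
| ty_call (G : shenv) X us Ts :
    G.[? X] = Some Ts -> uniq us -> size us = size Ts ->
    typing G (Call X us) (senv_of us Ts)
| ty_inp (G : shenv) u bs (D : senv) cs :
    unzip1 bs = unzip1 cs -> u \notin domf D ->
    (forall l x P, lookup l bs = Some (x, P) -> Var x \notin domf D /\ Var x != u) ->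
    (forall l x P S T,
       lookup l bs = Some (x, P) -> lookup l cs = Some (S, T) ->
       typing G P D.[u <- T].[Var x <- S]) ->
    typing G (Inp u bs) D.[u <- TBra cs]
| ty_out (G : shenv) u l v P (D : senv) S T :
    u \notin domf D -> v \notin domf D -> u != v -> stype S ->
    typing G P D.[u <- T] ->
    typing G (Out u l v P) D.[u <- TSel [:: (l, (S, T))]].[v <- S]
| ty_par (G : shenv) P1 P2 (D1 D2 : senv) :
    [disjoint domf D1 & domf D2] ->
    typing G P1 D1 -> typing G P2 D2 -> typing G (Par P1 P2) (D1 + D2)
| ty_plus (G : shenv) P1 P2 (D : senv) :
    typing G P1 D -> typing G P2 D -> typing G (Plus P1 P2) D
| ty_def (G : shenv) X xs Ts P Q (D : senv) :
    X \notin domf G -> uniq xs -> size xs = size Ts -> all stype Ts ->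
    typing G.[X <- Ts] P (senv_of (map Var xs) Ts) ->
    typing G.[X <- Ts] Q D ->
    typing G (Def X xs P Q) D
| ty_res (G : shenv) a b P (D : senv) T :
    a != b -> Chan a \notin domf D -> Chan b \notin domf D ->
    typing G P D.[Chan a <- T].[Chan b <- dual T] ->
    typing G (Res a b P) D.

(* |- C[a : S] |> 0 *)
Definition ectx_typing (C : ectx) (a : chan) (S : typ) : Prop :=
  exists2 X : pvar, X \notin ectx_pvs C &
    typing fmap0.[X <- [:: S]] (fill C (Call X [:: Chan a])) fmap0.

(* Main.v *)
(* Subject reduction for a more liberal, syntax-directed type system that is
   insensitive to alpha-conversion. Types are compared up to unfolding, all
   names of type [end] are unrestricted (the rules let them be duplicated and
   captured, since environments may drop them), and a declaration need not be
   typable if it is never called (structural congruence can introduce such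
   declarations). No reduct of a process typable there is [Err], because the two
   endpoints of a restriction always have compatible types, and a name with a
   type other than [end] occurs free. Since [T] is a subtype of [S], replacing
   the call [X<a>] of type [S] by a process of type [T] preserves typability. *)

From mathcomp Require Import all_boot finmap.
Require Import Defs.
From Stdlib Require Import FunctionalExtensionality ClassicalEpsilon.

Set Implicit Arguments.
Unset Strict Implicit.
Unset Printing Implicit Defensive.

Fixpoint every (A : Type) (p : A -> Prop) (s : seq A) : Prop :=
  if s is x :: s' then p x /\ every p s' else True.

Lemma every_impl (A : Type) (p q : A -> Prop) s :
  (forall x, p x -> q x) -> every p s -> every q s.
Proof. by move=> pq; elim: s => //= x s IH [/pq px /IH]. Qed.

Lemma every_and (A : Type) (p q : A -> Prop) s :
  every p s -> every q s -> every (fun x => p x /\ q x) s.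
Proof. by elim: s => //= x s IH [px /IH h] [qx /h]. Qed.

Lemma every_cat (A : Type) (p : A -> Prop) s s' :
  every p (s ++ s') <-> every p s /\ every p s'.
Proof. by elim: s => /= [|x s IH]; rewrite ?IH; tauto. Qed.

Lemma every_map (A B : Type) (f : A -> B) (p : B -> Prop) s :
  every p (map f s) <-> every (fun x => p (f x)) s.
Proof. by elim: s => //= x s IH; rewrite IH. Qed.

Lemma every_map_eq (A B : Type) (f g : A -> B) s :
  every (fun x => f x = g x) s -> map f s = map g s.
Proof. by elim: s => //= x s IH [-> /IH ->]. Qed.

Lemma lookup_Some (A : Type) l (bs : seq (label * A)) :
  lookup l bs <> None <-> l \in unzip1 bs.
Proof.
elim: bs => [|[k b] bs IH] //=; rewrite inE eq_sym.
by case: eqP => //=; rewrite IH.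
Qed.

Lemma every_lookup (A : Type) (p : label * A -> Prop) l bs b :
  every p bs -> lookup l bs = Some b -> p (l, b).
Proof.
elim: bs => [|[k c] bs IH] //= [pb ps].
by case: eqP => [<- [<-]|_ /(IH ps)].
Qed.

Lemma lookup_every (A : Type) (p : label * A -> Prop) bs :
  uniq (unzip1 bs) -> (forall l b, lookup l bs = Some b -> p (l, b)) ->
  every p bs.
Proof.
elim: bs => [|[k c] bs IH] //= /andP[kbs u] h; split.
  by apply: h; rewrite eqxx.
apply: IH => // l b hl; apply: h; case: eqP => // E.
by move: kbs; rewrite E; case/negP; apply/lookup_Some; rewrite hl.
Qed.

Lemma lookup_map (A B : Type) (f : A -> B) l (bs : seq (label * A)) :
  lookup l [seq (b.1, f b.2) | b <- bs] = omap f (lookup l bs).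
Proof. by elim: bs => [|[k b] bs IH] //=; case: eqP. Qed.

Lemma unzip1_map (A B : Type) (f : A -> B) (bs : seq (label * A)) :
  unzip1 [seq (b.1, f b.2) | b <- bs] = unzip1 bs.
Proof. by rewrite /unzip1 -map_comp. Qed.

(** * Types up to unfolding *)

Section TypInd.
Variable Pr : typ -> Prop.
Hypothesis hEnd : Pr TEnd.
Hypothesis hVar : forall t, Pr (TVar t).
Hypothesis hMu : forall t T, Pr T -> Pr (TMu t T).
Hypothesis hBra : forall bs, every (fun b => Pr b.2.1 /\ Pr b.2.2) bs -> Pr (TBra bs).
Hypothesis hSel : forall bs, every (fun b => Pr b.2.1 /\ Pr b.2.2) bs -> Pr (TSel bs).

Fixpoint typ_nested_ind (T : typ) : Pr T :=
  let fix go (bs : seq (label * (typ * typ))) : every (fun b => Pr b.2.1 /\ Pr b.2.2) bs :=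
    match bs with
    | [::] => I
    | b :: bs' =>
        conj (conj (typ_nested_ind b.2.1) (typ_nested_ind b.2.2)) (go bs')
    end in
  match T with
  | TEnd => hEnd
  | TVar t => hVar t
  | TMu t T => hMu t (typ_nested_ind T)
  | TBra bs => hBra (go bs)
  | TSel bs => hSel (go bs)
  end.
End TypInd.

Lemma tsubst_notin t U T : t \notin ftv T -> tsubst t U T = T.
Proof.
elim/typ_nested_ind: T => //= [s|s T IH|bs IH|bs IH].
- by rewrite inE eq_sym; case: eqP.
- by rewrite mem_filter eq_sym; case: eqP => //= _ /IH ->.
- move=> h; congr TBra; rewrite -[RHS]map_id; apply: every_map_eq.
  elim: bs IH h => //= -[l [S1 S2]] bs IHbs [/= [h1 h2] hs].
  rewrite !mem_cat !negb_or => /andP[/andP[/h1 -> /h2 ->] /(IHbs hs)]; tauto.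
- move=> h; congr TSel; rewrite -[RHS]map_id; apply: every_map_eq.
  elim: bs IH h => //= -[l [S1 S2]] bs IHbs [/= [h1 h2] hs].
  rewrite !mem_cat !negb_or => /andP[/andP[/h1 -> /h2 ->] /(IHbs hs)]; tauto.
Qed.

Lemma closed_ftv T t : closed_typ T -> t \notin ftv T.
Proof. by move/nilP => ->. Qed.

Lemma tsubst_closed t U T : closed_typ T -> tsubst t U T = T.
Proof. by move=> /closed_ftv h; apply: tsubst_notin. Qed.

Lemma dual_tsubst t U T :
  wf_typ T -> dual (tsubst t U T) = tsubst t (dual U) (dual T).
Proof.
elim/typ_nested_ind: T => //= [s|s T IH|bs IH|bs IH].
- by case: eqP.
- by case/andP=> _ wT; case: eqP => //= _; rewrite IH.
- case/andP=> _ wbs; congr TSel; rewrite -!map_comp; apply: every_map_eq.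
  elim: bs IH wbs => //= -[l [S1 S2]] bs IHbs [/= [_ h2] hs] /andP[/and3P[/= c _ /h2 ->] /(IHbs hs)].
  by move=> e; split=> //=; rewrite !(tsubst_closed _ _ c).
- case/andP=> _ wbs; congr TBra; rewrite -!map_comp; apply: every_map_eq.
  elim: bs IH wbs => //= -[l [S1 S2]] bs IHbs [/= [_ h2] hs] /andP[/and3P[/= c _ /h2 ->] /(IHbs hs)].
  by move=> e; split=> //=; rewrite !(tsubst_closed _ _ c).
Qed.

Lemma ftv_tsubst t U T s :
  closed_typ U -> s \in ftv (tsubst t U T) -> s \in ftv T /\ s != t.
Proof.
move=> cU; elim/typ_nested_ind: T => //= [r|r T IH|bs IH|bs IH].
- case: (r =P t) => [_ h|/= ne].
    by have := closed_ftv s cU; rewrite h.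
  by rewrite !inE => /eqP ->; split=> //; apply/eqP.
- case: (r =P t) => [->|/= _]; first by rewrite /= !mem_filter => /andP[-> ->].
  by rewrite !mem_filter => /andP[-> /IH[-> ->]].
- elim: bs IH => //= -[l [S1 S2]] bs IHbs [/= [h1 h2] /IHbs{}IHbs].
  rewrite !mem_cat => /orP[/orP[/h1|/h2]|/IHbs] [-> ->]; by rewrite ?orbT.
- elim: bs IH => //= -[l [S1 S2]] bs IHbs [/= [h1 h2] /IHbs{}IHbs].
  rewrite !mem_cat => /orP[/orP[/h1|/h2]|/IHbs] [-> ->]; by rewrite ?orbT.
Qed.

Lemma unguarded_ftv t T : unguarded t T -> t \in ftv T.
Proof.
elim: T => //= [s|s T IH]; first by rewrite inE eq_sym.
by case/andP=> ne /IH h; rewrite mem_filter eq_sym ne h.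
Qed.

Lemma unguarded_tsubst s t U T :
  closed_typ U -> unguarded s (tsubst t U T) -> unguarded s T.
Proof.
move=> cU; elim: T => //= [r|r T IH].
  by case: eqP => // _ /unguarded_ftv; rewrite (negbTE (closed_ftv _ cU)).
by case: eqP => //= _ /andP[-> /IH].
Qed.

Lemma wf_tsubst t U T :
  closed_typ U -> wf_typ U -> wf_typ T -> wf_typ (tsubst t U T).
Proof.
move=> cU wU; elim/typ_nested_ind: T => //= [r|r T IH|bs IH|bs IH].
- by case: eqP.
- case/andP=> ung wT; case: eqP => _ /=; first by rewrite ung wT.
  by rewrite IH // andbT; apply: contra ung => /unguarded_tsubst; apply.
- rewrite (unzip1_map (fun c => (tsubst t U c.1, tsubst t U c.2))).
  case/andP=> -> /=; elim: bs IH => //= -[l [S1 S2]] bs IHbs [/= [_ h2] /IHbs{}IHbs].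
  by case/andP=> /and3P[/= c w /h2 ->] /IHbs ->; rewrite tsubst_closed // c w.
- rewrite (unzip1_map (fun c => (tsubst t U c.1, tsubst t U c.2))).
  case/andP=> -> /=; elim: bs IH => //= -[l [S1 S2]] bs IHbs [/= [_ h2] /IHbs{}IHbs].
  by case/andP=> /and3P[/= c w /h2 ->] /IHbs ->; rewrite tsubst_closed // c w.
Qed.

Lemma stype_unfold t T : stype (TMu t T) -> stype (tsubst t (TMu t T) T).
Proof.
case/andP=> c w; have wT : wf_typ T by case/andP: w.
apply/andP; split; last exact: wf_tsubst.
apply/nilP; case E: (ftv _) => [//|s ss].
have /(ftv_tsubst c)[sT st] : s \in ftv (tsubst t (TMu t T) T).
  by rewrite E inE eqxx.
by have := closed_ftv s c; rewrite /= mem_filter sT st.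
Qed.

Lemma unfolds_stype T S : unfolds T S -> stype T -> stype S.
Proof. by elim=> // t {}T {}S _ IH /stype_unfold. Qed.

Lemma unfolds_dual T S : unfolds T S -> stype T -> unfolds (dual T) (dual S).
Proof.
elim=> [{}T _|t {}T {}S _ IH sT]; first exact: unfolds_refl.
apply: unfolds_mu; have := IH (stype_unfold sT).
by rewrite dual_tsubst //; case/andP: sT => _ /andP[].
Qed.

Definition hnf (T : typ) : bool :=
  match T with TEnd | TBra _ | TSel _ => true | _ => false end.

Fixpoint mus (T : typ) : nat := if T is TMu _ T then (mus T).+1 else 0.

Lemma mus_tsubst t U T : ~~ unguarded t T -> mus (tsubst t U T) = mus T.
Proof.
elim: T => //= [s|s T IH]; first by case: eqP.
by case: eqP => //= _ /IH ->.
Qed.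

Lemma stype_hnf T : stype T -> exists2 S, unfolds T S & hnf S.
Proof.
have [n] := ubnP (mus T); elim: n T => // n IH T le_n sT.
case: T sT le_n => [|t|t T|bs|bs] sT le_n.
- by exists TEnd => //; apply: unfolds_refl.
- by case/andP: sT.
- have [||S uS hS] := IH (tsubst t (TMu t T) T).
  + by rewrite mus_tsubst //; case/andP: sT => _ /andP[].
  + exact: stype_unfold.
  by exists S => //; apply: unfolds_mu.
- by exists (TBra bs) => //; apply: unfolds_refl.
- by exists (TSel bs) => //; apply: unfolds_refl.
Qed.

Lemma unfolds_inj T S S' :
  unfolds T S -> hnf S -> unfolds T S' -> hnf S' -> S = S'.
Proof.
elim=> [{}T|t {}T {}S _ IH] hS u; last first.
  by inversion u; subst => // hS'; apply: IH.
by inversion u; subst.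
Qed.

Definition isend (T : typ) : Prop := unfolds T TEnd.

Definition le_step (R : typ -> typ -> Prop) (T S : typ) : Prop :=
  [\/ T = S, isend T /\ isend S,
      exists bs cs, [/\ unfolds T (TBra bs), unfolds S (TBra cs) &
        forall l S1 S2, lookup l cs = Some (S1, S2) ->
          exists T1 T2, [/\ lookup l bs = Some (T1, T2), R T1 S1 & R T2 S2]]
    | exists bs cs, [/\ unfolds T (TSel bs), unfolds S (TSel cs) &
        forall l T1 T2, lookup l bs = Some (T1, T2) ->
          exists S1 S2, [/\ lookup l cs = Some (S1, S2), R S1 T1 & R T2 S2]]].

(* Subtyping up to unfolding, made reflexive on all raw types. *)
Definition le (T S : typ) : Prop :=
  exists2 R : typ -> typ -> Prop, forall T S, R T S -> le_step R T S & R T S.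

Lemma le_step_mono (R R' : typ -> typ -> Prop) T S :
  (forall T S, R T S -> R' T S) -> le_step R T S -> le_step R' T S.
Proof.
move=> RR [->|e|[bs [cs [u v h]]]|[bs [cs [u v h]]]].
- exact: Or41.
- exact: Or42.
- apply: Or43; exists bs, cs; split=> // l S1 S2 /h[T1 [T2 [? ? ?]]].
  by exists T1, T2; split; auto.
- apply: Or44; exists bs, cs; split=> // l S1 S2 /h[T1 [T2 [? ? ?]]].
  by exists T1, T2; split; auto.
Qed.

Lemma leE T S : le T S -> le_step le T S.
Proof.
by case=> R Rs /Rs; apply: le_step_mono => T' S' r; exists R.
Qed.

Lemma le_refl T : le T T.
Proof. by exists eq => // ? ? ->; apply: Or41. Qed.

Lemma le_end T S : isend T -> isend S -> le T S.
Proof.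
by move=> eT eS; exists (fun T S => isend T /\ isend S) => // ? ? e; apply: Or42.
Qed.

Lemma bra_inv T bs cs : unfolds T (TBra bs) -> unfolds T (TBra cs) -> bs = cs.
Proof. by move=> u v; case: (unfolds_inj u isT v isT). Qed.

Lemma sel_inv T bs cs : unfolds T (TSel bs) -> unfolds T (TSel cs) -> bs = cs.
Proof. by move=> u v; case: (unfolds_inj u isT v isT). Qed.

Lemma bra_sel T bs cs : unfolds T (TBra bs) -> unfolds T (TSel cs) -> False.
Proof. by move=> u v; case: (unfolds_inj u isT v isT). Qed.

Lemma bra_end T bs : unfolds T (TBra bs) -> isend T -> False.
Proof. by move=> u v; case: (unfolds_inj u isT v isT). Qed.

Lemma sel_end T bs : unfolds T (TSel bs) -> isend T -> False.
Proof. by move=> u v; case: (unfolds_inj u isT v isT). Qed.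

Lemma isend_TEnd : isend TEnd. Proof. exact: unfolds_refl. Qed.

Lemma le_bra_r T S cs : le T S -> unfolds S (TBra cs) ->
  exists2 bs, unfolds T (TBra bs) & forall l S1 S2, lookup l cs = Some (S1, S2) ->
    exists T1 T2, [/\ lookup l bs = Some (T1, T2), le T1 S1 & le T2 S2].
Proof.
move=> /leE[->|[_ e]|[bs [cs' [u v h]]]|[bs [cs' [u v h]]]] u'.
- by exists cs => // l S1 S2 hl; exists S1, S2; split=> //; apply: le_refl.
- by case: (bra_end u' e).
- by exists bs => //; rewrite (bra_inv u' v).
- by case: (bra_sel u' v).
Qed.

Lemma le_bra_l T S bs : le T S -> unfolds T (TBra bs) ->
  exists2 cs, unfolds S (TBra cs) & forall l S1 S2, lookup l cs = Some (S1, S2) ->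
    exists T1 T2, [/\ lookup l bs = Some (T1, T2), le T1 S1 & le T2 S2].
Proof.
move=> /leE[->|[e _]|[bs' [cs [u v h]]]|[bs' [cs [u v h]]]] u'.
- by exists bs => // l S1 S2 hl; exists S1, S2; split=> //; apply: le_refl.
- by case: (bra_end u' e).
- by exists cs => //; rewrite (bra_inv u' u).
- by case: (bra_sel u' u).
Qed.

Lemma le_sel_r T S cs : le T S -> unfolds S (TSel cs) ->
  exists2 bs, unfolds T (TSel bs) & forall l T1 T2, lookup l bs = Some (T1, T2) ->
    exists S1 S2, [/\ lookup l cs = Some (S1, S2), le S1 T1 & le T2 S2].
Proof.
move=> /leE[->|[_ e]|[bs [cs' [u v h]]]|[bs [cs' [u v h]]]] u'.
- by exists cs => // l S1 S2 hl; exists S1, S2; split=> //; apply: le_refl.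
- by case: (sel_end u' e).
- by case: (bra_sel v u').
- by exists bs => //; rewrite (sel_inv u' v).
Qed.

Lemma le_sel_l T S bs : le T S -> unfolds T (TSel bs) ->
  exists2 cs, unfolds S (TSel cs) & forall l T1 T2, lookup l bs = Some (T1, T2) ->
    exists S1 S2, [/\ lookup l cs = Some (S1, S2), le S1 T1 & le T2 S2].
Proof.
move=> /leE[->|[e _]|[bs' [cs [u v h]]]|[bs' [cs [u v h]]]] u'.
- by exists bs => // l S1 S2 hl; exists S1, S2; split=> //; apply: le_refl.
- by case: (sel_end u' e).
- by case: (bra_sel u u').
- by exists cs => //; rewrite (sel_inv u' u).
Qed.

Lemma le_isend T S : le T S -> isend T <-> isend S.
Proof.
move=> /leE[->|[eT eS]|[bs [cs [u v _]]]|[bs [cs [u v _]]]] //.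
- by split=> [/(bra_end u)|/(bra_end v)].
- by split=> [/(sel_end u)|/(sel_end v)].
Qed.

Lemma le_trans T S U : le T S -> le S U -> le T U.
Proof.
move=> TS SU; exists (fun T U => exists2 S, le T S & le S U); last by exists S.
move=> {TS SU}T {}U [{}S TS SU].
case: (leE SU) => [<-|[eS eU]|[bs [cs [u v h]]]|[bs [cs [u v h]]]].
- apply: (@le_step_mono le); last exact: leE.
  by move=> T' S' h; exists S' => //; apply: le_refl.
- by apply: Or42; split=> //; apply/(le_isend TS).
- have [as_ w h'] := le_bra_r TS u; apply: Or43; exists as_, cs; split=> //.
  move=> l U1 U2 /h[S1 [S2 [/h'[T1 [T2 [hl ? ?]]] ? ?]]].
  by exists T1, T2; split=> //; [exists S1|exists S2].
- have [as_ w h'] := le_sel_r TS u; apply: Or44; exists as_, cs; split=> //.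
  move=> l U1 U2 /h'[S1 [S2 [/h[T1 [T2 [hl ? ?]]] ? ?]]].
  by exists T1, T2; split=> //; [exists S1|exists S2].
Qed.

(* [compat T S]: whatever an endpoint following [T] does is accepted by a
   co-endpoint following [S]; equivalently, [T] is a subtype of the dual of
   [S]. *)
Definition compat_step (R : typ -> typ -> Prop) (T S : typ) : Prop :=
  [\/ isend T /\ isend S,
      exists bs cs, [/\ unfolds T (TBra bs), unfolds S (TSel cs) &
        forall l S1 S2, lookup l cs = Some (S1, S2) ->
          exists T1 T2, [/\ lookup l bs = Some (T1, T2), le T1 S1 & R T2 S2]]
    | exists bs cs, [/\ unfolds T (TSel bs), unfolds S (TBra cs) &
        forall l T1 T2, lookup l bs = Some (T1, T2) ->
          exists S1 S2, [/\ lookup l cs = Some (S1, S2), le S1 T1 & R T2 S2]]].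

Definition compat (T S : typ) : Prop :=
  exists2 R : typ -> typ -> Prop, forall T S, R T S -> compat_step R T S & R T S.

Lemma compatE T S : compat T S -> compat_step compat T S.
Proof.
case=> R Rs /Rs[e|[bs [cs [u v h]]]|[bs [cs [u v h]]]].
- exact: Or31.
- apply: Or32; exists bs, cs; split=> // l S1 S2 /h[T1 [T2 [? ? ?]]].
  by exists T1, T2; split=> //; exists R.
- apply: Or33; exists bs, cs; split=> // l S1 S2 /h[T1 [T2 [? ? ?]]].
  by exists T1, T2; split=> //; exists R.
Qed.

Lemma compat_end T S : isend T -> isend S -> compat T S.
Proof.
by move=> eT eS; exists (fun T S => isend T /\ isend S) => // ? ? e; apply: Or31.
Qed.

Lemma compat_le T S S' : compat T S -> le S' S -> compat T S'.
Proof.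
move=> TS SS; exists (fun T S' => exists2 S, compat T S & le S' S); last by exists S.
move=> {TS SS}T {}S' [{}S TS SS].
case: (compatE TS) => [[eT eS]|[bs [cs [u v h]]]|[bs [cs [u v h]]]].
- by apply: Or31; split=> //; apply/(le_isend SS).
- have [ds w h'] := le_sel_r SS v; apply: Or32; exists bs, ds; split=> //.
  move=> l S1' S2' /h'[S1 [S2 [/h[T1 [T2 [hl a b]]] c d]]].
  by exists T1, T2; split=> //; [apply: le_trans c|exists S2].
- have [ds w h'] := le_bra_r SS v; apply: Or33; exists bs, ds; split=> //.
  move=> l T1 T2 /h[S1 [S2 [/h'[S1' [S2' [hl a b]]] c d]]].
  by exists S1', S2'; split=> //; [apply: le_trans c|exists S2].
Qed.

Lemma compat_end_iff T S : compat T S -> isend T <-> isend S.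
Proof.
move=> /compatE[[eT eS]|[bs [cs [u v _]]]|[bs [cs [u v _]]]] //.
- by split=> [/(bra_end u)|/(sel_end v)].
- by split=> [/(sel_end u)|/(bra_end v)].
Qed.

Lemma stype_lookup bs l T1 T2 :
  stype (TBra bs) -> lookup l bs = Some (T1, T2) -> stype T1 /\ stype T2.
Proof.
case/andP=> /nilP c /andP[_ w].
elim: bs c w => //= -[k [S1 S2]] bs IH /=.
case E1: (ftv S1) => //; case E2: (ftv S2) => //= h.
case/andP=> /and3P[c w1 w2] ws; case: eqP => [_ [<- <-]|_]; last exact: IH.
by split; apply/andP; split; rewrite /closed_typ ?E1 ?E2 /= ?w1 ?w2 //.
Qed.

Lemma lookup_stype bs : uniq (unzip1 bs) ->
  (forall l T1 T2, lookup l bs = Some (T1, T2) -> stype T1 /\ stype T2) ->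
  stype (TBra bs).
Proof.
move=> u h; have {h} : every (fun b => stype b.2.1 /\ stype b.2.2) bs.
  by apply: lookup_every => // l [T1 T2] /h.
move=> h; rewrite /stype /= u /=.
suff: closed_typ (TBra bs) /\
  all (fun b => [&& closed_typ b.2.1, wf_typ b.2.1 & wf_typ b.2.2]) bs by case=> -> ->.
elim: bs {u} h => //= -[k [S1 S2]] bs IH [/= [/andP[c1 w1] /andP[c2 w2]] /IH[c a]].
split; last by rewrite c1 w1 w2.
by rewrite /closed_typ /= (nilP c1) (nilP c2).
Qed.

Lemma stype_sel bs : stype (TSel bs) = stype (TBra bs).
Proof. by []. Qed.

Lemma compat_dual T : stype T -> compat T (dual T).
Proof.
move=> sT; exists (fun T S => stype T /\ S = dual T) => // {sT}T S [sT ->].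
have [T0 u hT] := stype_hnf sT.
have := unfolds_dual u sT; have := unfolds_stype u sT.
case: T0 u hT => //= [|bs|bs] u _ sT0 v.
- exact: Or31.
- apply: Or32; eexists _, _; split; [exact: u|exact: v|].
  move=> l S1 S2; rewrite (lookup_map (fun c => (c.1, dual c.2))).
  case E: lookup => [[T1 T2]|] //= [<- <-].
  by exists T1, T2; split=> //; [apply: le_refl|case: (stype_lookup sT0 E)].
- apply: Or33; eexists _, _; split; [exact: u|exact: v|].
  move=> l T1 T2 E; exists T1, (dual T2).
  rewrite (lookup_map (fun c => (c.1, dual c.2))) E; split=> //.
    exact: le_refl.
  by rewrite stype_sel in sT0; case: (stype_lookup sT0 E).
Qed.

Lemma tree_eq_sym T S : tree_eq T S -> tree_eq S T.
Proof.
move: T S; cofix CIH => T S; case=> {T S} T S.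
- by move=> u v; apply: tree_eq_end.
- move=> bs cs u v i h; apply: (tree_eq_bra v u) => [l|l S1 S2 T1 T2 e e'].
    by rewrite i.
  by split; apply: CIH; case: (h _ _ _ _ _ e' e).
- move=> bs cs u v i h; apply: (tree_eq_sel v u) => [l|l S1 S2 T1 T2 e e'].
    by rewrite i.
  by split; apply: CIH; case: (h _ _ _ _ _ e' e).
Qed.

Lemma lookup_eqi (A B : Type) (bs : seq (label * A)) (cs : seq (label * B)) l b :
  unzip1 bs =i unzip1 cs -> lookup l bs = Some b -> exists c, lookup l cs = Some c.
Proof.
move=> i e; case E: (lookup l cs) => [c|]; first by exists c.
have : l \in unzip1 cs by rewrite -i; apply/lookup_Some; rewrite e.
by move/lookup_Some.
Qed.

Lemma tree_eq_le T S : tree_eq T S -> le T S.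
Proof.
move=> h; exists (fun T S => tree_eq T S \/ tree_eq S T); last by left.
suff H T' S' : tree_eq T' S' -> le_step (fun T S => tree_eq T S \/ tree_eq S T) T' S'.
  by move=> T' S' [e|/tree_eq_sym e]; apply: H.
case=> {h T' S'} {}T {}S.
- by move=> u v; apply: Or42.
- move=> bs cs u v i h; apply: Or43; exists bs, cs; split=> // l S1 S2 e.
  have [[T1 T2] e'] := lookup_eqi (fun k => esym (i k)) e.
  by have [h1 h2] := h _ _ _ _ _ e' e; exists T1, T2; split; auto.
- move=> bs cs u v i h; apply: Or44; exists bs, cs; split=> // l S1 S2 e.
  have [[T1 T2] e'] := lookup_eqi i e.
  by have [h1 h2] := h _ _ _ _ _ e e'; exists T1, T2; split; auto.
Qed.

Lemma tree_eq_isend T : tree_eq T TEnd -> isend T.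
Proof. by move/tree_eq_le/le_isend => ->; apply: isend_TEnd. Qed.

Lemma subtype_le T S : subtype T S -> le T S.
Proof.
move=> h.
exists (fun T S => exists T' S', [/\ le T T', subtype T' S' & le S' S]); last first.
  by exists T, S; split=> //; apply: le_refl.
move=> {h}T {}S [T' [S' [TT TS SS]]].
case: TS TT SS => {T' S'} T' S'.
- move=> _ _ /tree_eq_isend eT /tree_eq_isend eS TT SS; apply: Or42.
  by split; [apply/(le_isend TT)|apply/(le_isend SS)].
- move=> bs cs _ _ /tree_eq_le tT /tree_eq_sym/tree_eq_le tS h TT SS.
  have [bs' u hb] := le_bra_r (le_trans TT tT) (unfolds_refl _).
  have [cs' v hc] := le_bra_l (le_trans tS SS) (unfolds_refl _).
  apply: Or43; exists bs', cs'; split=> // l S1 S2.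
  move=> /hc[S1' [S2' [/h[T1' [T2' [/hb[T1 [T2 [e ? ?]]] ? ?]]] ? ?]]].
  by exists T1, T2; split=> //; [exists T1', S1'|exists T2', S2'].
- move=> bs cs _ _ /tree_eq_le tT /tree_eq_sym/tree_eq_le tS h TT SS.
  have [bs' u hb] := le_sel_r (le_trans TT tT) (unfolds_refl _).
  have [cs' v hc] := le_sel_l (le_trans tS SS) (unfolds_refl _).
  apply: Or44; exists bs', cs'; split=> // l S1 S2.
  move=> /hb[S1' [S2' [/h[T1' [T2' [/hc[T1 [T2 [e ? ?]]] ? ?]]] ? ?]]].
  by exists T1, T2; split=> //; [exists T1', S1'|exists S2', T2'].
Qed.

(** * Linear typing on locations *)

Section ProcInd.
Variable Pr : proc -> Prop.
Hypothesis hNil : Pr Nil.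
Hypothesis hCall : forall X us, Pr (Call X us).
Hypothesis hInp : forall u bs, every (fun b => Pr b.2.2) bs -> Pr (Inp u bs).
Hypothesis hOut : forall u l v P, Pr P -> Pr (Out u l v P).
Hypothesis hPar : forall P Q, Pr P -> Pr Q -> Pr (Par P Q).
Hypothesis hPlus : forall P Q, Pr P -> Pr Q -> Pr (Plus P Q).
Hypothesis hDef : forall X xs P Q, Pr P -> Pr Q -> Pr (Def X xs P Q).
Hypothesis hRes : forall a b P, Pr P -> Pr (Res a b P).
Hypothesis hErr : Pr Err.

Fixpoint proc_nested_ind (P : proc) : Pr P :=
  let fix go (bs : seq (label * (cvar * proc))) : every (fun b => Pr b.2.2) bs :=
    match bs with
    | [::] => I
    | b :: bs' => conj (proc_nested_ind b.2.2) (go bs')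
    end in
  match P with
  | Nil => hNil
  | Call X us => hCall X us
  | Inp u bs => hInp u (go bs)
  | Out u l v P => hOut u l v (proc_nested_ind P)
  | Par P Q => hPar (proc_nested_ind P) (proc_nested_ind Q)
  | Plus P Q => hPlus (proc_nested_ind P) (proc_nested_ind Q)
  | Def X xs P Q => hDef X xs (proc_nested_ind P) (proc_nested_ind Q)
  | Res a b P => hRes a b (proc_nested_ind P)
  | Err => hErr
  end.
End ProcInd.

Fixpoint fid (P : proc) : seq ident :=
  match P with
  | Nil | Err => [::]
  | Call _ us => us
  | Inp u bs => u :: flatten [seq [seq v <- fid b.2.2 | v != Var b.2.1] | b <- bs]
  | Out u _ v P => [:: u, v & fid P]
  | Par P Q | Plus P Q => fid P ++ fid Q
  | Def _ xs P Q => [seq v <- fid P | v \notin map Var xs] ++ fid Q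
  | Res a b P => [seq v <- fid P | v \notin [:: Chan a; Chan b]]
  end.

Lemma every_sub_flatten (A : Type) (B : eqType) (g : A -> seq B) s :
  every (fun a => {subset g a <= flatten (map g s)}) s.
Proof.
elim: s => //= a s IH; split=> [b|]; first by rewrite mem_cat => ->.
by apply: every_impl IH => c h b /h; rewrite mem_cat orbC => ->.
Qed.

Lemma flatten_subset (A : Type) (B C : eqType) (g : A -> seq B) (h : A -> seq C)
    (k : B -> C) s :
  every (fun a => forall b, b \in g a -> k b \in h a) s ->
  forall b, b \in flatten (map g s) -> k b \in flatten (map h s).
Proof.
elim: s => //= a s IH [ha hs] b; rewrite !mem_cat => /orP[/ha ->//|/(IH hs) ->].
exact: orbT.
Qed.

Lemma fid_ids P : {subset fid P <= ids P}.
Proof.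
elim/proc_nested_ind: P => //= [X us|u bs IH|u l v P IH|P Q IHP IHQ|P Q IHP IHQ|X xs P Q IHP IHQ|a b P IH] w //.
- rewrite !inE => /orP[->//|h]; apply/orP; right.
  apply: (flatten_subset (k := id)) h; apply: every_impl IH => b h w'.
  by rewrite mem_filter inE => /andP[_ /h ->]; rewrite orbT.
- by rewrite !inE => /or3P[->|->|/IH ->]; rewrite ?orbT.
- by rewrite !mem_cat => /orP[/IHP ->|/IHQ ->]; rewrite ?orbT.
- by rewrite !mem_cat => /orP[/IHP ->|/IHQ ->]; rewrite ?orbT.
- by rewrite !mem_cat mem_filter => /orP[/andP[_ /IHP ->]|/IHQ ->]; rewrite ?orbT.
- by rewrite mem_filter !inE => /andP[_ /IH ->]; rewrite !orbT.
Qed.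

Lemma ichanE c u : (c \in ichan u) = (u == Chan c).
Proof. by case: u => //= a; rewrite inE eq_sym. Qed.

Lemma fid_fc P c : Chan c \in fid P -> c \in fc P.
Proof.
elim/proc_nested_ind: P c => //= [X us|u bs IH|u l v P IH|P Q IHP IHQ|P Q IHP IHQ|X xs P Q IHP IHQ|a b P IH] c.
- by move=> h; apply/flatten_mapP; exists (Chan c) => //; rewrite ichanE.
- rewrite inE mem_cat ichanE eq_sym => /orP[->//|h]; apply/orP; right.
  elim: bs IH h => //= b bs IHbs [IHb /IHbs{}IHbs].
  rewrite !mem_cat mem_filter => /orP[/andP[_ /IHb ->//]|/IHbs ->].
  exact: orbT.
- by rewrite !inE !mem_cat !ichanE ![Chan c == _]eq_sym => /or3P[->|->|/IH ->]; rewrite ?orbT.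
- by rewrite !mem_cat => /orP[/IHP ->|/IHQ ->]; rewrite ?orbT.
- by rewrite !mem_cat => /orP[/IHP ->|/IHQ ->]; rewrite ?orbT.
- by rewrite !mem_cat mem_filter => /orP[/andP[_ /IHP ->]|/IHQ ->]; rewrite ?orbT.
- by rewrite !mem_filter !inE => /andP[/= h /IH ->]; rewrite andbT.
Qed.

Definition bind (A : Type) (us : seq ident) (r : ident -> A) (u : ident) : A + nat :=
  if u \in us then inr (index u us) else inl (r u).

Definition benv (A : Type) (D : A -> typ) (Ts : seq typ) (z : A + nat) : typ :=
  match z with inl z => D z | inr i => nth TEnd Ts i end.

Definition upd (A : eqType) (D : A -> typ) (z : A) (T : typ) (w : A) : typ :=
  if w == z then T else D w.

Definition keep (A : Type) (s : A -> bool) (D : A -> typ) (z : A) : typ :=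
  if s z then D z else TEnd.

Definition penv := pvar -> option (seq typ).

Definition pupd (G : penv) (X : pvar) (o : option (seq typ)) (Y : pvar) :=
  if Y == X then o else G Y.

(* [f] is, on the non-end part of [E], a bijection onto the non-end part of
   [D] which only weakens types. *)
Definition embeds (A B : Type) (f : A -> B) (E : A -> typ) (D : B -> typ) : Prop :=
  [/\ forall a, ~ isend (E a) -> le (E a) (D (f a)),
      forall a a', ~ isend (E a) -> ~ isend (E a') -> f a = f a' -> a = a' &
      forall b, ~ isend (D b) -> exists2 a, ~ isend (E a) & f a = b].

Definition pvar_fun (A : Type) (r : ident -> A) (us : seq ident) (i : nat) : A :=
  r (nth (Chan 0) us i).

(* [ty P r G D] types [P] when each identifier [u] denotes the location [r u]
   and location [z] is used according to [D z]. Locations of type [end] are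
   unrestricted. A binder extends the locations [A] to [A + nat], the i-th
   bound name denoting [inr i]. The second alternative for [Def] accepts an
   untypable declaration that is never called: structural congruence creates
   those, from [Nil]. *)
Fixpoint ty (P : proc) (A : eqType) (r : ident -> A) (G : penv) (D : A -> typ)
    {struct P} : Prop :=
  match P with
  | Nil => forall z, isend (D z)
  | Err => False
  | Call X us => exists Ts, [/\ G X = Some Ts, size us = size Ts &
      embeds (pvar_fun r us) (nth TEnd Ts) D]
  | Inp u bs => exists cs,
      [/\ unfolds (D (r u)) (TBra cs), bs <> [::],
          forall l, lookup l cs <> None -> lookup l bs <> None &
          every (fun b => exists S T,
            (forall S' T', lookup b.1 cs = Some (S', T') -> le S S' /\ le T T') /\
            ty b.2.2 (bind [:: Var b.2.1] r) G (benv (upd D (r u) T) [:: S])) bs]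
  | Out u l v P => exists cs S T,
      [/\ unfolds (D (r u)) (TSel cs), lookup l cs = Some (S, T) &
          (isend S /\ ty P r G (upd D (r u) T)) \/
          [/\ ~ isend S, r v <> r u, le S (D (r v)) &
              ty P r G (upd (upd D (r u) T) (r v) TEnd)]]
  | Par P Q => exists s : A -> bool,
      ty P r G (keep s D) /\ ty Q r G (keep (negb \o s) D)
  | Plus P Q => ty P r G D /\ ty Q r G D
  | Def X xs P Q =>
      (exists Ts, [/\ uniq xs, size xs = size Ts,
         ty P (fun u => index u (map Var xs)) (pupd G X (Some Ts)) (nth TEnd Ts) &
         ty Q r (pupd G X (Some Ts)) D]) \/
      ty Q r (pupd G X None) D
  | Res a b P => a <> b /\ exists T S,
      compat T S /\ ty P (bind [:: Chan a; Chan b] r) G (benv D [:: T; S])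
  end.

Lemma embeds_id (A : Type) (D D' : A -> typ) :
  (forall z, le (D z) (D' z)) -> embeds id D D'.
Proof.
move=> h; split=> // z e.
by exists z => //; rewrite (le_isend (h z)).
Qed.

Lemma le_not_end T S : le T S -> ~ isend T -> ~ isend S.
Proof. by move=> /le_isend ->. Qed.

Lemma embeds_trans (A B C : Type) (f : A -> B) (g : B -> C) h E D D' :
  embeds f E D -> embeds g D D' -> (forall a, ~ isend (E a) -> h a = g (f a)) ->
  embeds h E D'.
Proof.
move=> [f1 f2 f3] [g1 g2 g3] hE; split=> [a na|a a' na na'|c nc].
- rewrite hE //; apply: le_trans (f1 a na) (g1 _ _).
  exact: le_not_end (f1 _ na) na.
- rewrite !hE // => /g2 e; apply: f2 => //; apply: e.
    exact: le_not_end (f1 _ na) na.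
  exact: le_not_end (f1 _ na') na'.
- have [b nb <-] := g3 _ nc; have [a na <-] := f3 _ nb.
  by exists a => //; apply: hE.
Qed.

Lemma embeds_upd (A B : eqType) (f : A -> B) D D' z T :
  embeds f D D' -> ~ isend (D z) -> embeds f (upd D z T) (upd D' (f z) T).
Proof.
move=> [f1 f2 f3] nz; split=> [a|a a'|b]; rewrite /upd.
- case: eqP => [-> _|ne na]; first by rewrite eqxx; apply: le_refl.
  by case: eqP => [/f2 e|_]; [case: ne; apply: e|apply: f1].
- case: eqP => [->|ne]; case: eqP => [->|ne'] // na na'.
  + by move=> /f2 ->.
  + by move=> /f2 ->.
  + exact: f2.
- case: eqP => [-> nT|ne /f3[a na fa]]; first by exists z; rewrite ?eqxx.
  exists a => //; case: eqP => // e; by case: ne; rewrite -fa e.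
Qed.

Definition bmap (A B : Type) (f : A -> B) (z : A + nat) : B + nat :=
  match z with inl a => inl (f a) | inr i => inr i end.

Lemma embeds_bmap (A B : Type) (f : A -> B) D D' Ts :
  embeds f D D' -> embeds (bmap f) (benv D Ts) (benv D' Ts).
Proof.
move=> [f1 f2 f3]; split=> [[a|i]|[a|i] [a'|i']|[b|i]] //=.
- exact: f1.
- by move=> _; apply: le_refl.
- by move=> na na' [] /f2 ->.
- by move=> _ _ [->].
- by move=> /f3[a na <-]; exists (inl a).
- by move=> n; exists (inr i).
Qed.

Lemma embeds_keep (A B : Type) (f : A -> B) D D' (s : A -> bool) :
  embeds f D D' -> exists s' : B -> bool,
    embeds f (keep s D) (keep s' D') /\
    embeds f (keep (negb \o s) D) (keep (negb \o s') D').
Proof.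
move=> [f1 f2 f3].
pose p b := exists a, [/\ ~ isend (D a), s a & f a = b].
pose s' b := if excluded_middle_informative (p b) then true else false.
have s'P b : reflect (p b) (s' b).
  by rewrite /s'; case: excluded_middle_informative => h; constructor.
have s'f a : ~ isend (D a) -> s' (f a) = s a.
  move=> na; apply/s'P/idP => [[a' [na' sa' /f2 <- //]]|sa].
  by exists a.
exists s'; rewrite /keep; split; split=> [a|a a'|b] /=.
- case: ifP => [sa na|_ /(_ isend_TEnd)//].
  by rewrite s'f // sa; apply: f1.
- case: ifP => [sa|_ /(_ isend_TEnd)//]; case: ifP => [sa'|_ _ /(_ isend_TEnd)//].
  exact: f2.
- case: s'P => [[a [na sa fa]] _|_ /(_ isend_TEnd)//].
  by exists a => //; rewrite sa.
- case: ifP => [sa na|_ /(_ isend_TEnd)//].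
  by rewrite s'f // sa; apply: f1.
- case: ifP => [sa|_ /(_ isend_TEnd)//]; case: ifP => [sa'|_ _ /(_ isend_TEnd)//].
  exact: f2.
- case: ifP => [sb nb|_ /(_ isend_TEnd)//].
  have [a na fa] := f3 _ nb; exists a => //.
  by rewrite -(s'f a na) fa sb.
Qed.

Lemma bind_bmap (A B : Type) (f : A -> B) (r : ident -> A) (r' : ident -> B)
    D Ts us u :
  (u \notin us -> ~ isend (D (r u)) -> r' u = f (r u)) ->
  ~ isend (benv D Ts (bind us r u)) -> bind us r' u = bmap f (bind us r u).
Proof. by rewrite /bind; case: (u \in us) => //= h n; rewrite (h isT n). Qed.

Lemma upd_not_end (A : eqType) (D : A -> typ) z T w :
  ~ isend (D z) -> ~ isend (upd D z T w) -> ~ isend (D w).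
Proof. by rewrite /upd; case: eqP => [->|]. Qed.

Lemma keep_not_end (A : Type) (D : A -> typ) s z :
  ~ isend (keep s D z) -> s z /\ ~ isend (D z).
Proof. by rewrite /keep; case: ifP => // _ /(_ isend_TEnd). Qed.

Lemma nth_not_end Ts i : ~ isend (nth TEnd Ts i) -> i < size Ts.
Proof.
by rewrite ltnNge => h; apply/negP => le_s; apply: h; rewrite nth_default //; apply: isend_TEnd.
Qed.

Lemma ty_map P (A B : eqType) (f : A -> B) r r' (G G' : penv) D D' :
  ty P r G D -> embeds f D D' ->
  (forall u, u \in fid P -> ~ isend (D (r u)) -> r' u = f (r u)) ->
  (forall X Ts, X \in fpv P -> G X = Some Ts -> G' X = Some Ts) ->
  ty P r' G' D'.
Proof.
elim/proc_nested_ind: P A B f r r' G G' D D' =>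
  [|X us|u bs IH|u l v P IH|P Q IHP IHQ|P Q IHP IHQ|X xs P Q IHP IHQ|a b P IH|]
  A B f r r' G G' D D' //=.
- move=> h [_ _ f3] _ _ z; case: (classic (isend (D' z))) => // /f3[w].
  by case; apply: h.
- move=> [Ts [GX sz emb]] fD hr hG; exists Ts; split=> //.
    by apply: hG; rewrite ?inE.
  apply: (embeds_trans emb fD) => i ni; apply: hr.
    by rewrite mem_nth // sz; apply: nth_not_end.
  by case: emb => e _ _; apply: le_not_end (e _ ni) ni.
- move=> [cs [uf ne lk bsP]] fD hr hG.
  have nu : ~ isend (D (r u)) by move/(bra_end uf).
  have eu : r' u = f (r u) by apply: hr; rewrite ?inE ?eqxx.
  have [f1 f2 f3] := fD.
  have [cs' uf' h] := le_bra_l (f1 _ nu) uf.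
  have h1 := every_sub_flatten (fun b => [seq v <- fid b.2.2 | v != Var b.2.1]) bs.
  have h2 := every_sub_flatten (fun b : _ * (cvar * proc) => fpv b.2.2) bs.
  exists cs'; split=> //.
  + by rewrite eu.
  + move=> l; case E: lookup => [[S1 S2]|] // _; apply: lk.
    by have [T1 [T2 [-> _ _]]] := h _ _ _ E.
  have := every_and (every_and IH bsP) (every_and h1 h2).
  apply: every_impl => -[l [x P]] /= [[IHP [S [T [le_ST tP]]]] [sub1 sub2]].
  exists S, T; split.
    move=> S' T' /h[S1 [T1 [/le_ST[a b] c d]]].
    by split; [apply: le_trans c|apply: le_trans d].
  apply: IHP tP _ _ _.
  + by apply: embeds_bmap; rewrite eu; apply: embeds_upd.
  + move=> v vP nv; apply: (bind_bmap _ nv) => nvx nv'.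
    apply: hr; last exact: upd_not_end nv'.
    rewrite inE; apply/orP; right; apply: sub1; rewrite mem_filter vP andbT.
    by move: nvx; rewrite inE.
  + by move=> Y Ts YP; apply: hG; apply: sub2.
- move=> [cs [S [T [uf lk tP]]]] fD hr hG.
  have nu : ~ isend (D (r u)) by move/(sel_end uf).
  have eu : r' u = f (r u) by apply: hr; rewrite ?inE ?eqxx.
  have [f1 f2 f3] := fD.
  have [cs' uf' h] := le_sel_l (f1 _ nu) uf.
  have [S' [T' [lk' leS leT]]] := h _ _ _ lk.
  exists cs', S', T'; split=> //; first by rewrite eu.
  have updP : embeds f (upd D (r u) T) (upd D' (f (r u)) T').
    have := embeds_upd T fD nu; move/embeds_trans; apply; last first.
      by move=> z _; apply: (erefl (id (f z))).
    by apply: embeds_id => z; rewrite /upd; case: eqP => // _; apply: le_refl.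
  case: tP => [[eS tP]|[nS ne leSv tP]]; [left|right].
    split; first by case: (le_isend leS) => _; apply.
    apply: IH tP _ _ hG; first by rewrite eu; apply: updP.
    by move=> w wP /(upd_not_end nu); apply: hr; rewrite !inE wP !orbT.
  have nv : ~ isend (D (r v)) by apply: le_not_end leSv nS.
  have ev : r' v = f (r v) by apply: hr; rewrite ?inE ?eqxx ?orbT.
  split.
  + by move/(le_isend leS).
  + by rewrite eu ev => /f2 e; apply: ne; apply: e.
  + by rewrite ev; apply: le_trans leS (le_trans leSv (f1 _ nv)).
  apply: IH tP _ _ hG.
    rewrite eu ev; apply: embeds_upd => //.
    by rewrite /upd; case: eqP.
  move=> w wP nw; apply: hr; first by rewrite !inE wP !orbT.
  apply: (upd_not_end (T := T) nu); apply: upd_not_end nw.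
  by rewrite /upd; case: eqP.
- move=> [s [tP tQ]] fD hr hG; have [s' [e1 e2]] := embeds_keep s fD.
  exists s'; split.
    apply: IHP tP e1 _ _ => [u uP nk|X Ts XP].
      by have [_ nu] := keep_not_end nk; apply: hr; rewrite ?mem_cat ?uP.
    by apply: hG; rewrite ?mem_cat ?XP.
  apply: IHQ tQ e2 _ _ => [u uP nk|X Ts XP].
    by have [_ nu] := keep_not_end nk; apply: hr; rewrite ?mem_cat ?uP ?orbT.
  by apply: hG; rewrite ?mem_cat ?XP ?orbT.
- move=> [tP tQ] fD hr hG; split.
    apply: IHP tP fD _ _ => [u uP|X Ts XP].
      by apply: hr; rewrite ?mem_cat ?uP.
    by apply: hG; rewrite ?mem_cat ?XP.
  apply: IHQ tQ fD _ _ => [u uP|X Ts XP].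
    by apply: hr; rewrite ?mem_cat ?uP ?orbT.
  by apply: hG; rewrite ?mem_cat ?XP ?orbT.
- move=> tPQ fD hr hG.
  have hP o Y Ts : Y \in fpv P -> pupd G X o Y = Some Ts -> pupd G' X o Y = Some Ts.
    rewrite /pupd => YP; case: eqP => // /eqP ne; apply: hG.
    by rewrite mem_filter ne mem_cat YP.
  have hQ o Y Ts : Y \in fpv Q -> pupd G X o Y = Some Ts -> pupd G' X o Y = Some Ts.
    rewrite /pupd => YQ; case: eqP => // /eqP ne; apply: hG.
    by rewrite mem_filter ne mem_cat YQ orbT.
  have hrQ u : u \in fid Q -> ~ isend (D (r u)) -> r' u = f (r u).
    by move=> uQ; apply: hr; rewrite mem_cat uQ orbT.
  case: tPQ => [[Ts [uxs sz tP tQ]]|tQ].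
    left; exists Ts; split=> //.
      apply: (IHP _ _ id _ _ _ _ _ _ tP); [|by []|exact: hP].
      by apply: embeds_id => z; apply: le_refl.
    exact: IHQ tQ fD hrQ (hQ _).
  by right; apply: IHQ tQ fD hrQ (hQ _).
- move=> [ab [T [S [c tP]]]] fD hr hG; split=> //; exists T, S; split=> //.
  apply: IH tP (embeds_bmap _ fD) _ hG => u uP nu.
  by apply: (bind_bmap _ nu) => ne; apply: hr; rewrite mem_filter ne.
Qed.

Lemma ty_sub P (A : eqType) (r : ident -> A) G D D' :
  ty P r G D -> (forall z, le (D z) (D' z)) -> ty P r G D'.
Proof. by move=> tP h; apply: ty_map tP (embeds_id h) _ _. Qed.

Lemma ty_ext P (A : eqType) (r r' : ident -> A) (G G' : penv) D :
  {in fid P, r =1 r'} -> {in fpv P, G =1 G'} -> ty P r G D <-> ty P r' G' D.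
Proof.
move=> hr hG.
have eD : embeds id D D by apply: embeds_id => z; apply: le_refl.
split=> tP; apply: ty_map tP eD _ _.
- by move=> u /hr.
- by move=> X Ts /hG ->.
- by move=> u /hr.
- by move=> X Ts /hG <-.
Qed.

Lemma ty_used P (A : eqType) (r : ident -> A) G D z :
  ty P r G D -> ~ isend (D z) -> exists2 u, u \in fid P & r u = z.
Proof.
elim/proc_nested_ind: P A r G D z =>
  [|X us|u bs IH|u l v P IH|P Q IHP IHQ|P Q IHP IHQ|X xs P Q IHP IHQ|a b P IH|]
  A r G D z //=.
- move=> [Ts [_ sz [_ _ h]]] /h[i /nth_not_end ni <-].
  by exists (nth (Chan 0) us i) => //; rewrite mem_nth // sz.
- move=> [cs [_ ne _]]; case: bs IH ne => //= -[l [x P]] bs /= [IH _] _.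
  move=> [[S [T [_ tP]]] _] nz.
  have [<-|/eqP ne] := (r u =P z); first by exists u; rewrite ?inE ?eqxx.
  have [|v vP] := IH _ _ _ _ (inl z) tP.
    by rewrite /= /upd eq_sym (negbTE ne).
  rewrite /bind inE; case: eqP => // /eqP nvx [<-].
  by exists v => //; rewrite inE mem_cat mem_filter nvx vP orbT.
- move=> [cs [S [T [_ _ tP]]]] nz.
  have [<-|/eqP ne] := (r u =P z); first by exists u; rewrite ?inE ?eqxx.
  have [<-|/eqP ne'] := (r v =P z); first by exists v; rewrite ?inE ?eqxx ?orbT.
  case: tP => [[_ tP]|[_ _ _ tP]].
    have [|w wP <-] := IH _ _ _ _ z tP; first by rewrite /upd eq_sym (negbTE ne).
    by exists w; rewrite ?inE ?wP ?orbT.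
  have [|w wP <-] := IH _ _ _ _ z tP.
    by rewrite /upd eq_sym (negbTE ne') eq_sym (negbTE ne).
  by exists w; rewrite ?inE ?wP ?orbT.
- move=> [s [tP tQ]] nz; case E: (s z).
    have [|w wP <-] := IHP _ _ _ _ z tP; first by rewrite /keep E.
    by exists w; rewrite ?mem_cat ?wP.
  have [|w wP <-] := IHQ _ _ _ _ z tQ; first by rewrite /keep /= E.
  by exists w; rewrite ?mem_cat ?wP ?orbT.
- move=> [tP _] nz; have [w wP <-] := IHP _ _ _ _ z tP nz.
  by exists w; rewrite ?mem_cat ?wP.
- move=> h nz; have [G' tQ] : exists G', ty Q r G' D.
    by case: h => [[Ts [_ _ _ h]]|h]; eexists; exact: h.
  have [w wP <-] := IHQ _ _ _ _ z tQ nz.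
  by exists w; rewrite ?mem_cat ?wP ?orbT.
- move=> [_ [T [S [_ tP]]]] nz; have [//|u uP] := IH _ _ _ _ (inl z) tP.
  rewrite /bind; case: ifP => // /negbT nu [<-].
  by exists u => //; rewrite mem_filter nu.
Qed.

Lemma every_flatten (A : Type) (B : eqType) (g : A -> seq B) (p : A -> Prop) s b :
  b \in flatten (map g s) -> every p s -> exists2 a, b \in g a & p a.
Proof.
elim: s => //= a s IH; rewrite mem_cat => /orP[ba [pa _]|/IH h [_ /h]//].
by exists a.
Qed.

Lemma ty_subject P (A : eqType) (r : ident -> A) G D c :
  c \in sc P -> ty P r G D -> ~ isend (D (r (Chan c))).
Proof.
elim/proc_nested_ind: P A r G D c =>
  [|X us|u bs IH|u l v P IH|P Q IHP IHQ|P Q IHP IHQ|X xs P Q IHP IHQ|a b P IH|]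
  A r G D c //=.
- rewrite mem_cat ichanE => h [cs [uf _ _ tbs]].
  case: eqP h => [<- _|_ /= h]; first by move/(bra_end uf).
  have [[l [x P]] /= cP [IHP [S [T [_ tP]]]]] := every_flatten h (every_and IH tbs).
  by apply: upd_not_end (IHP _ _ _ _ _ cP tP); move/(bra_end uf).
- rewrite mem_cat ichanE => h [cs [S [T [uf _ tP]]]].
  case: eqP h => [<- _|_ /= cP]; first by move/(sel_end uf).
  have nu : ~ isend (D (r u)) by move/(sel_end uf).
  case: tP => [[_ tP]|[_ _ _ tP]]; apply: (upd_not_end (T := T) nu).
    exact: IH cP tP.
  by have := IH _ _ _ _ _ cP tP; rewrite {1}/upd; case: eqP => // _ /(_ isend_TEnd).
- rewrite mem_cat => /orP[cP|cQ] [s [tP tQ]].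
    by have [] := keep_not_end (IHP _ _ _ _ _ cP tP).
  by have [] := keep_not_end (IHQ _ _ _ _ _ cQ tQ).
- by rewrite mem_cat => /orP[cP|cQ] [tP tQ]; [apply: IHP cP tP|apply: IHQ cQ tQ].
- by move=> cQ [[Ts [_ _ _ tQ]]|tQ]; apply: IHQ cQ tQ.
- rewrite mem_filter => /andP[ne cP] [_ [T [S [_ tP]]]].
  have := IH _ _ _ _ _ cP tP; rewrite /bind.
  by move: ne; rewrite !inE => /negbTE; rewrite /= => ->.
Qed.

Lemma every_iff (A : Type) (p q : A -> Prop) s :
  every (fun x => p x <-> q x) s -> every p s <-> every q s.
Proof. by elim: s => //= x s IH [-> /IH ->]. Qed.

Fixpoint bids (P : proc) : seq ident :=
  match P with
  | Nil | Err | Call _ _ => [::]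
  | Inp _ bs => flatten [seq Var b.2.1 :: bids b.2.2 | b <- bs]
  | Out _ _ _ P => bids P
  | Par P Q | Plus P Q => bids P ++ bids Q
  | Def _ xs P Q => map Var xs ++ bids P ++ bids Q
  | Res a b P => [:: Chan a, Chan b & bids P]
  end.

Lemma bids_ids P : {subset bids P <= ids P}.
Proof.
elim/proc_nested_ind: P => //= [u bs IH|u l v P IH|P Q IHP IHQ|P Q IHP IHQ|X xs P Q IHP IHQ|a b P IH] w.
- rewrite inE => h; apply/orP; right.
  apply: (flatten_subset (k := id)) h; apply: every_impl IH => b h w'.
  by rewrite !inE => /orP[->//|/h ->]; rewrite orbT.
- by move=> /IH; rewrite !inE => ->; rewrite ?orbT.
- by rewrite !mem_cat => /orP[/IHP ->|/IHQ ->]; rewrite ?orbT.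
- by rewrite !mem_cat => /orP[/IHP ->|/IHQ ->]; rewrite ?orbT.
- by rewrite !mem_cat => /or3P[->|/IHP ->|/IHQ ->]; rewrite ?orbT.
- by rewrite !inE => /or3P[->|->|/IH ->]; rewrite ?orbT.
Qed.

Lemma bids_bc P c : Chan c \in bids P -> c \in bc P.
Proof.
elim/proc_nested_ind: P c => //= [u bs IH|P Q IHP IHQ|P Q IHP IHQ|X xs P Q IHP IHQ|a b P IH] c.
- elim: bs IH => //= b bs IHbs [IHb /IHbs{}IHbs].
  by rewrite !inE /= !mem_cat => /orP[/IHb ->//|/IHbs ->]; rewrite orbT.
- by rewrite !mem_cat => /orP[/IHP ->|/IHQ ->]; rewrite ?orbT.
- by rewrite !mem_cat => /orP[/IHP ->|/IHQ ->]; rewrite ?orbT.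
- rewrite !mem_cat => /or3P[/mapP[]//|/IHP ->|/IHQ ->]; by rewrite ?orbT.
- by rewrite !inE => /or3P[/eqP[->]|/eqP[->]|/IH ->]; rewrite ?eqxx ?orbT.
Qed.

Definition no_capture (us : seq ident) (s : ident -> ident) : Prop :=
  forall u, s u \in us -> u = s u.

Lemma no_capture_mask us vs s : no_capture us s -> no_capture us (mask vs s).
Proof. by move=> h u; rewrite /mask; case: ifP => // _; apply: h. Qed.

Lemma no_capture_sub us vs s : {subset us <= vs} -> no_capture vs s -> no_capture us s.
Proof. by move=> sub h u /sub; apply: h. Qed.

Lemma bind_mask (A : Type) us s (r : ident -> A) :
  no_capture us s -> bind us r \o mask us s = bind us (r \o s).
Proof.
move=> nc; apply: functional_extensionality => u; rewrite /bind /mask /=.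
case: (boolP (u \in us)) => [->//|nu]; case: ifP => // su.
by move: nu; rewrite (nc _ su) su.
Qed.

Lemma index_mask us s : no_capture us s ->
  (fun u => index u us) \o mask us s = (fun u => index u us).
Proof.
move=> nc; apply: functional_extensionality => u; rewrite /mask /=.
case: (boolP (u \in us)) => // nu.
have : s u \notin us by apply: contra nu => su; rewrite (nc _ su).
by move: nu; rewrite -!index_mem -!leqNgt => h h'; apply/eqP; rewrite eqn_leq
  (leq_trans (index_size _ _) h) (leq_trans (index_size _ _) h').
Qed.

Lemma embeds_ext (A B : Type) (f g : A -> B) E D :
  (forall a, ~ isend (E a) -> g a = f a) -> embeds f E D -> embeds g E D.
Proof.
move=> fg e; apply: embeds_trans e _ fg.
by apply: embeds_id => z; apply: le_refl.
Qed.

Lemma pvar_fun_map (A : eqType) (r : ident -> A) s us Ts D : size us = size Ts ->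
  embeds (pvar_fun r (map s us)) (nth TEnd Ts) D <->
  embeds (pvar_fun (r \o s) us) (nth TEnd Ts) D.
Proof.
move=> sz; have h i : ~ isend (nth TEnd Ts i) ->
    pvar_fun r (map s us) i = pvar_fun (r \o s) us i.
  by move/nth_not_end => lt_i; rewrite /pvar_fun (nth_map (Chan 0)) ?sz.
by split; apply: embeds_ext => i /h.
Qed.

Lemma ty_subst P (A : eqType) (r : ident -> A) G D s :
  no_capture (bids P) s -> ty (subst s P) r G D <-> ty P (r \o s) G D.
Proof.
elim/proc_nested_ind: P A r G D s =>
  [|X us|u bs IH|u l v P IH|P Q IHP IHQ|P Q IHP IHQ|X xs P Q IHP IHQ|a b P IH|]
  A r G D s //= nc.
- split=> [] [Ts [GX sz emb]]; exists Ts; split=> //.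
  + by rewrite -sz size_map.
  + by apply/pvar_fun_map; rewrite -?sz ?size_map.
  + by rewrite size_map.
  + by apply/pvar_fun_map.
- have lkE l : lookup l [seq (b.1, (b.2.1, subst (mask [:: Var b.2.1] s) b.2.2)) | b <- bs]
      <> None <-> lookup l bs <> None.
    by rewrite (lookup_Some _ bs) -(unzip1_map (fun c => (c.1, subst (mask [:: Var c.1] s) c.2))) -lookup_Some.
  have bE cs : every (fun b => exists S T,
            (forall S' T', lookup b.1 cs = Some (S', T') -> le S S' /\ le T T') /\
            ty b.2.2 (bind [:: Var b.2.1] r) G (benv (upd D (r (s u)) T) [:: S]))
      [seq (b.1, (b.2.1, subst (mask [:: Var b.2.1] s) b.2.2)) | b <- bs] <->
      every (fun b => exists S T,
            (forall S' T', lookup b.1 cs = Some (S', T') -> le S S' /\ le T T') /\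
            ty b.2.2 (bind [:: Var b.2.1] (r \o s)) G (benv (upd D (r (s u)) T) [:: S])) bs.
    rewrite every_map; apply: every_iff.
    have := every_sub_flatten (fun b => Var b.2.1 :: bids b.2.2) bs.
    move/(every_and IH); apply: every_impl => -[l [x P]] /= [{}IH sub].
    have nx : no_capture [:: Var x] s.
      by apply: no_capture_sub nc => w; rewrite inE => /eqP ->; apply: sub; rewrite inE eqxx.
    have nP : no_capture (bids P) (mask [:: Var x] s).
      apply: no_capture_mask; apply: no_capture_sub nc => w wP.
      by apply: sub; rewrite inE wP orbT.
    split=> [] [S [T [h tP]]]; exists S, T; split=> //.
      by move/IH: tP => /(_ nP); rewrite bind_mask.
    by apply/IH => //; rewrite bind_mask.
  split=> [] [cs [uf ne lk tbs]]; exists cs; split=> //.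
  + by move=> e; apply: ne; rewrite e.
  + by move=> l /lk /lkE.
  + by apply/bE.
  + by case: (bs) ne.
  + by move=> l /lk /lkE.
  + by apply/bE.
- by split=> [] [cs [S [T [uf lk h]]]]; exists cs, S, T; split=> //;
  (case: h => [[eS tP]|[nS ne leS tP]]; [left|right]; split=> //); apply/IH.
- by split=> [] [k [tP tQ]]; exists k; split; [apply/IHP|apply/IHQ|apply/IHP|apply/IHQ] => //;
    apply: no_capture_sub nc => w; rewrite mem_cat => ->; rewrite ?orbT.
- by split=> [] [tP tQ]; split; [apply/IHP|apply/IHQ|apply/IHP|apply/IHQ] => //;
    apply: no_capture_sub nc => w; rewrite mem_cat => ->; rewrite ?orbT.
- have nQ : no_capture (bids Q) s.
    by apply: no_capture_sub nc => w; rewrite !mem_cat => ->; rewrite ?orbT.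
  have nx : no_capture (map Var xs) s.
    by apply: no_capture_sub nc => w; rewrite !mem_cat => ->; rewrite ?orbT.
  have nP : no_capture (bids P) (mask (map Var xs) s).
    apply: no_capture_mask.
    by apply: no_capture_sub nc => w; rewrite !mem_cat => ->; rewrite ?orbT.
  split=> [] [[Ts [uxs sz tP tQ]]|tQ]; [left|right|left|right].
  + exists Ts; split=> //; last exact/IHQ.
    by move/IHP: tP => /(_ nP); rewrite index_mask.
  + exact/IHQ.
  + exists Ts; split=> //; last exact/IHQ.
    by apply/IHP => //; rewrite index_mask.
  + exact/IHQ.
- have nab : no_capture [:: Chan a; Chan b] s.
    by apply: no_capture_sub nc => w; rewrite !inE => /orP[->|->]; rewrite ?orbT.
  have nP : no_capture (bids P) (mask [:: Chan a; Chan b] s).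
    apply: no_capture_mask.
    by apply: no_capture_sub nc => w wP; rewrite !inE wP !orbT.
  split=> [] [ab [T [S [c tP]]]]; split=> //; exists T, S; split=> //.
    by move/IH: tP => /(_ nP); rewrite bind_mask.
  by apply/IH => //; rewrite bind_mask.
Qed.

Lemma ty_prename P X Y (A : eqType) (r : ident -> A) G D : Y \notin pvs P ->
  ty (prename X Y P) r G D <-> ty P r (fun Z => G (if Z == X then Y else Z)) D.
Proof.
have pupdE (G' : penv) Z o : Z != X -> Z != Y ->
  (fun W => pupd G' Z o (if W == X then Y else W)) =
  pupd (fun W => G' (if W == X then Y else W)) Z o.
  move=> ZX ZY; apply: functional_extensionality => W; rewrite /pupd.
  by case: (W =P X) => // ->; rewrite eq_sym (negbTE ZY) eq_sym (negbTE ZX).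
have pupdX (G' : penv) o :
  pupd (fun W => G' (if W == X then Y else W)) X o = pupd G' X o.
  by apply: functional_extensionality => W; rewrite /pupd; case: (W =P X).
elim/proc_nested_ind: P A r G D =>
  [|Z us|u bs IH|u l v P IH|P Q IHP IHQ|P Q IHP IHQ|Z xs P Q IHP IHQ|a b P IH|]
  A r G D //= nY.
- have lkE l : lookup l [seq (b.1, (b.2.1, prename X Y b.2.2)) | b <- bs]
      <> None <-> lookup l bs <> None.
    by rewrite (lookup_Some _ bs) -(unzip1_map (fun c => (c.1, prename X Y c.2))) -lookup_Some.
  have bE cs : every (fun b => exists S T,
            (forall S' T', lookup b.1 cs = Some (S', T') -> le S S' /\ le T T') /\
            ty b.2.2 (bind [:: Var b.2.1] r) G (benv (upd D (r u) T) [:: S]))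
      [seq (b.1, (b.2.1, prename X Y b.2.2)) | b <- bs] <->
      every (fun b => exists S T,
            (forall S' T', lookup b.1 cs = Some (S', T') -> le S S' /\ le T T') /\
            ty b.2.2 (bind [:: Var b.2.1] r) (fun Z => G (if Z == X then Y else Z))
              (benv (upd D (r u) T) [:: S])) bs.
    rewrite every_map; apply: every_iff.
    have := every_sub_flatten (fun b : _ * (cvar * proc) => pvs b.2.2) bs.
    move/(every_and IH); apply: every_impl => -[l [x P]] /= [{}IH sub].
    have nP : Y \notin pvs P by apply: contra nY => /sub.
    by split=> [] [S [T [h tP]]]; exists S, T; split=> //; apply/IH.
  split=> [] [cs [uf ne lk tbs]]; exists cs; split=> //.
  + by move=> e; apply: ne; rewrite e.
  + by move=> l /lk /lkE.
  + by apply/bE.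
  + by case: (bs) ne.
  + by move=> l /lk /lkE.
  + by apply/bE.
- by split=> [] [cs [S [T [uf lk h]]]]; exists cs, S, T; split=> //;
  (case: h => [[eS tP]|[nS ne leS tP]]; [left|right]; split=> //); apply/IH.
- move: nY; rewrite mem_cat negb_or => /andP[nP nQ].
  by split=> [] [k [tP tQ]]; exists k; split; [apply/IHP|apply/IHQ|apply/IHP|apply/IHQ].
- move: nY; rewrite mem_cat negb_or => /andP[nP nQ].
  by split=> [] [tP tQ]; split; [apply/IHP|apply/IHQ|apply/IHP|apply/IHQ].
- move: nY; rewrite inE mem_cat !negb_or => /and3P[YZ nP nQ].
  case: (Z =P X) => [->|/eqP ZX] /=; first by rewrite pupdX; split=> [] [[Ts h]|h];
    [left; exists Ts; move: h|right; move: h|left; exists Ts; move: h|right; move: h];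
    rewrite ?pupdX.
  have ZY : Z != Y by rewrite eq_sym.
  split=> [] [[Ts [uxs sz tP tQ]]|tQ]; [left; exists Ts|right|left; exists Ts|right].
  + by split=> //; rewrite -pupdE //; [apply/IHP|apply/IHQ].
  + by rewrite -pupdE //; apply/IHQ.
  + by split=> //; [apply/IHP|apply/IHQ] => //; rewrite pupdE.
  + by apply/IHQ => //; rewrite pupdE.
- by split=> [] [ab [T [S [c tP]]]]; split=> //; exists T, S; split=> //; apply/IH.
Qed.

Lemma repl1E b b' u : repl [:: b] [:: b'] u = if u == b then b' else u.
Proof. by rewrite /repl /= eq_sym; case: eqP. Qed.

Lemma ty_rename P b b' (A : eqType) (r r' : ident -> A) G D :
  b' \notin ids P -> (forall u, u <> b' -> r' (repl [:: b] [:: b'] u) = r u) ->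
  ty (subst (repl [:: b] [:: b']) P) r' G D <-> ty P r G D.
Proof.
move=> nb h; rewrite ty_subst.
  apply: ty_ext => // u /fid_ids uP; apply: h => e; by rewrite -e uP in nb.
move=> u; rewrite repl1E; case: eqP => // _ /bids_ids; by rewrite (negbTE nb).
Qed.

Lemma index_repl us vs b b' u : b \notin us ++ vs -> b' \notin us ++ vs -> u <> b' ->
  index (repl [:: b] [:: b'] u) (us ++ b' :: vs) = index u (us ++ b :: vs).
Proof.
rewrite repl1E !mem_cat !negb_or !index_cat /= => /andP[nb _] /andP[nb' _] /eqP ne.
case: (u =P b) => [->|/eqP neb]; first by rewrite (negbTE nb) (negbTE nb') !eqxx.
by rewrite eq_sym (negbTE ne) eq_sym (negbTE neb).
Qed.

Lemma bind_repl (A : Type) (r : ident -> A) us vs b b' u :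
  b \notin us ++ vs -> b' \notin us ++ vs -> u <> b' ->
  bind (us ++ b' :: vs) r (repl [:: b] [:: b'] u) = bind (us ++ b :: vs) r u.
Proof.
move=> nb nb' ne; have e := index_repl nb nb' ne.
rewrite /bind -!index_mem e !size_cat /=; case: ifP => //.
rewrite repl1E; case: eqP => // ->.
by rewrite index_cat; case: ifP; rewrite /= ?eqxx ?addn0 ?addnS ?ltnS ?leq_addr // => bu;
   rewrite mem_cat bu in nb.
Qed.

Lemma ty_inp_congr (A : eqType) (r : ident -> A) G D u bs l x y P Q cs :
  (forall D, ty P (bind [:: Var x] r) G D -> ty Q (bind [:: Var y] r) G D) ->
  ty (Inp u (bs ++ (l, (x, P)) :: cs)) r G D ->
  ty (Inp u (bs ++ (l, (y, Q)) :: cs)) r G D.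
Proof.
move=> h [ds [uf ne lk tbs]]; exists ds; split=> //.
- by case: (bs).
- by move=> k /lk/lookup_Some e; apply/lookup_Some; move: e; rewrite /unzip1 !map_cat.
move: tbs; rewrite !every_cat /= => -[hb [[S [T [e tP]]] hc]]; split=> //; split=> //.
by exists S, T; split=> //; apply: h.
Qed.

Lemma fpv_pvs P : {subset fpv P <= pvs P}.
Proof.
elim/proc_nested_ind: P => //= [X us|u bs IH|P Q IHP IHQ|P Q IHP IHQ|X xs P Q IHP IHQ] Y //.
- exact: (flatten_subset (k := id)).
- by rewrite !mem_cat => /orP[/IHP ->|/IHQ ->]; rewrite ?orbT.
- by rewrite !mem_cat => /orP[/IHP ->|/IHQ ->]; rewrite ?orbT.
- by rewrite mem_filter inE !mem_cat => /andP[_ /orP[/IHP ->|/IHQ ->]]; rewrite ?orbT.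
Qed.

Lemma alpha_ty P Q : alpha_ax P Q ->
  forall (A : eqType) (r : ident -> A) G D, ty P r G D <-> ty Q r G D.
Proof.
case=> {P Q}.
- move=> u bs l x y P cs ny A r G D.
  split; apply: ty_inp_congr => D'; rewrite (ty_rename (r := bind [:: Var x] r)) //;
    by move=> v; apply: (@bind_repl _ r [::] [::]).
- move=> X xs x y ys P Q nx ny nyP A r G D /=.
  have vE z : (Var z \in map Var xs ++ map Var ys) = (z \in xs ++ ys).
    by rewrite -map_cat mem_map // => ? ? [].
  have uE : uniq (xs ++ x :: ys) = uniq (xs ++ y :: ys).
    by rewrite -!(cat1s _ ys) !(uniq_catCA xs) /= nx ny.
  have sE : size (xs ++ x :: ys) = size (xs ++ y :: ys) by rewrite !size_cat.
  have tE G' D' : ty (subst (repl [:: Var x] [:: Var y]) P)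
      (fun u => index u (map Var (xs ++ y :: ys))) G' D' <->
      ty P (fun u => index u (map Var (xs ++ x :: ys))) G' D'.
    apply: ty_rename => // v ne; rewrite !map_cat /=.
    by apply: index_repl => //; rewrite vE.
  by split=> [] [[Ts [u sz tP tQ]]|tQ]; [left; exists Ts|right|left; exists Ts|right];
    rewrite // ?tE -?uE -?sE ?uE ?sE //; split; rewrite ?tE // -?uE -?sE //; move/tE: tP.
- move=> X Y xs P Q nP nQ A r G D /=.
  have E R (B : eqType) (q : ident -> B) D' o : Y \notin pvs R ->
      ty (prename X Y R) q (pupd G Y o) D' <-> ty R q (pupd G X o) D'.
    move=> nR; rewrite ty_prename //; apply: ty_ext => // Z /fpv_pvs ZR.
    rewrite /pupd; case: (Z =P X) => [_|_]; first by rewrite eqxx.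
    by case: eqP => // e; rewrite -e ZR in nR.
  by split=> [] [[Ts [u sz tP tQ]]|tQ]; [left; exists Ts|right|left; exists Ts|right];
    (split || idtac) => //; apply/E.
- move=> a a' b P ab a'b na A r G D /=.
  have h D' : ty (subst (repl [:: Chan a] [:: Chan a']) P) (bind [:: Chan a'; Chan b] r) G D'
      <-> ty P (bind [:: Chan a; Chan b] r) G D'.
    by apply: ty_rename => // v; apply: (@bind_repl _ r [::] [:: Chan b]);
      rewrite inE; apply/eqP => -[]; apply/eqP.
  by split=> [] [_ [T [S [c tP]]]]; (split; first exact/eqP);
    exists T, S; split=> //; apply/h.
- move=> a b b' P ab ab' nb A r G D /=.
  have h D' : ty (subst (repl [:: Chan b] [:: Chan b']) P) (bind [:: Chan a; Chan b'] r) G D'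
      <-> ty P (bind [:: Chan a; Chan b] r) G D'.
    apply: ty_rename => // v; apply: (@bind_repl _ r [:: Chan a] [::]); rewrite inE.
      by apply: contra ab => /eqP[->].
    by apply: contra ab' => /eqP[->].
  by split=> [] [_ [T [S [c tP]]]]; (split; first exact/eqP);
    exists T, S; split=> //; apply/h.
Qed.

(** * Structural congruence *)

Lemma ty_eqD P (A : eqType) (r : ident -> A) G D D' :
  ty P r G D -> D =1 D' -> ty P r G D'.
Proof. by move=> tP e; apply: ty_sub tP _ => z; rewrite e; apply: le_refl. Qed.

Lemma ty_pupd P (A : eqType) (r : ident -> A) G D X o :
  X \notin fpv P -> ty P r (pupd G X o) D <-> ty P r G D.
Proof.
move=> nX; apply: ty_ext => // Y YP; rewrite /pupd; case: eqP => // e.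
by rewrite -e YP in nX.
Qed.

Lemma pupdC G X Y o o' : X != Y -> pupd (pupd G X o) Y o' = pupd (pupd G Y o') X o.
Proof.
move=> ne; apply: functional_extensionality => Z; rewrite /pupd.
by case: (Z =P Y) => // ->; rewrite eq_sym (negbTE ne).
Qed.

Lemma ty_def_def X xs P Y ys Q O (A : eqType) (r : ident -> A) G D :
  X != Y -> X \notin fpv Q -> Y \notin fpv P ->
  ty (Def X xs P (Def Y ys Q O)) r G D -> ty (Def Y ys Q (Def X xs P O)) r G D.
Proof.
move=> ne nQ nP /=.
have tOE o o' : ty O r (pupd (pupd G X o) Y o') D -> ty O r (pupd (pupd G Y o') X o) D.
  by rewrite pupdC.
have tPE (B : eqType) (q : ident -> B) o o' D' :
    ty P q (pupd G X o) D' -> ty P q (pupd (pupd G Y o') X o) D'.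
  by rewrite -(pupdC _ _ _ ne) (ty_pupd _ _ _ _ nP).
have tQE (B : eqType) (q : ident -> B) o o' D' :
    ty Q q (pupd (pupd G X o) Y o') D' -> ty Q q (pupd G Y o') D'.
  by rewrite (pupdC _ _ _ ne) (ty_pupd _ _ _ _ nQ).
case=> [[Ts [u sz tP]]|] [[Us [u' sz' tQ tO]]|tO].
- left; exists Us; split=> //; first exact: tQE tQ.
  by left; exists Ts; split; auto.
- by right; left; exists Ts; split; auto.
- by left; exists Us; split; [| |exact: tQE tQ|right; apply: tOE].
- by right; right; apply: tOE.
Qed.

Lemma keep_le (A : Type) (D : A -> typ) s z :
  (~~ s z -> isend (D z)) -> le (keep s D z) (D z).
Proof.
rewrite /keep; case: (s z) => /= h; first exact: le_refl.
by apply: le_end; [apply: isend_TEnd|apply: h].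
Qed.

Lemma ty_nil_par P (A : eqType) (r : ident -> A) G D :
  ty (Par Nil P) r G D <-> ty P r G D.
Proof.
split=> [[s [/= h tP]]|tP].
  apply: ty_sub tP _ => z; apply: keep_le; rewrite /= negbK => sz.
  by have := h z; rewrite /keep sz.
exists (fun _ => false); split; first by move=> z; apply: isend_TEnd.
exact: ty_eqD tP _.
Qed.

Lemma ty_parC P Q (A : eqType) (r : ident -> A) G D :
  ty (Par P Q) r G D -> ty (Par Q P) r G D.
Proof.
move=> [s [tP tQ]]; exists (negb \o s); split=> //.
by apply: ty_eqD tP _ => z; rewrite /keep /= negbK.
Qed.

Lemma ty_parA P Q O (A : eqType) (r : ident -> A) G D :
  ty (Par P (Par Q O)) r G D <-> ty (Par (Par P Q) O) r G D.
Proof.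
split=> /=.
  move=> [s [tP [s' [tQ tO]]]]; exists (fun z => s z || s' z); split; first exists s; try split.
  - by apply: ty_eqD tP _ => z; rewrite /keep; case: (s z).
  - by apply: ty_eqD tQ _ => z; rewrite /keep /=; case: (s z); case: (s' z).
  - by apply: ty_eqD tO _ => z; rewrite /keep /=; case: (s z); case: (s' z).
move=> [s [[s' [tP tQ]] tO]]; exists (fun z => s z && s' z); split; last exists s; try split.
- by apply: ty_eqD tP _ => z; rewrite /keep; case: (s z); case: (s' z).
- by apply: ty_eqD tQ _ => z; rewrite /keep /=; case: (s z); case: (s' z).
- by apply: ty_eqD tO _ => z; rewrite /keep /=; case: (s z); case: (s' z).
Qed.

Lemma bind_notin (A : Type) us (r : ident -> A) u : u \notin us -> bind us r u = inl (r u).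
Proof. by rewrite /bind => /negbTE ->. Qed.

Lemma fid_notin P a b u : a \notin fc P -> b \notin fc P -> u \in fid P ->
  u \notin [:: Chan a; Chan b].
Proof.
move=> na nb uP; apply/negP; rewrite !inE => /orP[/eqP e|/eqP e];
by move: uP; rewrite e => /fid_fc; apply/negP.
Qed.

(* The inverse of [inl], whose value on bound locations is irrelevant. *)
Definition unbind (A : Type) (d : A) (z : A + nat) : A := if z is inl a then a else d.

Lemma ty_res_par a b P Q (A : eqType) (r : ident -> A) G D :
  a \notin fc Q -> b \notin fc Q ->
  ty (Par (Res a b P) Q) r G D <-> ty (Res a b (Par P Q)) r G D.
Proof.
move=> na nb; split=> /=.
  move=> [s [[ab [T [S [c tP]]]] tQ]]; split=> //; exists T, S; split=> //.
  exists (fun z => if z is inl a then s a else true); split.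
    by apply: ty_eqD tP _ => -[z|i].
  apply: (ty_map (f := inl) tQ) => //.
    by split=> [z _|z z' _ _ []//|[z|i] //= nz];
      [apply: le_refl|exists z|case: nz; apply: isend_TEnd].
  by move=> u uQ _; apply/bind_notin/(fid_notin na nb).
move=> [ab [T [S [c [s [tP tQ]]]]]].
have endQ i : isend (keep (negb \o s) (benv D [:: T; S]) (inr i)).
  case: (classic (isend (keep (negb \o s) (benv D [:: T; S]) (inr i)))) => // /(ty_used tQ).
  by case=> u /(fid_notin na nb) nu; rewrite (bind_notin r nu).
exists (s \o inl); split.
  split=> //; exists T, S; split=> //; apply: ty_sub tP _ => -[z|i] /=; first exact: le_refl.
  by apply: keep_le => nsi; have := endQ i; rewrite /keep /= nsi.
apply: (ty_map (f := unbind (r (Chan a))) tQ) => //.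
  split=> [[z|i]|[z|i] [z'|i']|z nz] //=; try by move=> nz; case: nz; apply: endQ.
  all: try by move=> _ nz; case: nz; apply: endQ.
  - by move=> _; apply: le_refl.
  - by move=> _ _ ->.
  - by exists (inl z).
by move=> u /(fid_notin na nb) nu _; rewrite (bind_notin r nu).
Qed.

Definition swap_locs (A : Type) (z : (A + nat) + nat) : (A + nat) + nat :=
  match z with
  | inl (inl a) => inl (inl a)
  | inl (inr i) => inr i
  | inr i => inl (inr i)
  end.

Lemma swap_locsK (A : Type) : involutive (@swap_locs A).
Proof. by case=> [[]|]. Qed.

Lemma bindC (A : Type) us vs (r : ident -> A) u : ~~ has [in us] vs ->
  bind us (bind vs r) u = swap_locs (bind vs (bind us r) u).
Proof.
move=> h; rewrite /bind; case: (boolP (u \in vs)) => [uv|]; last by case: ifP.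
by rewrite (negbTE (hasPn h _ uv)).
Qed.

Lemma ty_res_res a b c d P (A : eqType) (r : ident -> A) G D :
  a \notin [:: c; d] -> b \notin [:: c; d] ->
  ty (Res a b (Res c d P)) r G D -> ty (Res c d (Res a b P)) r G D.
Proof.
move=> na nb [ab [T [S [cTS [cd [U [V [cUV tP]]]]]]]].
split=> //; exists U, V; split=> //; split=> //; exists T, S; split=> //.
apply: (ty_map (f := @swap_locs A) tP) => //.
  split=> [[[z|i]|i] _|z z' _ _ /(can_inj (@swap_locsK A)) //|z nz].
  - exact: le_refl.
  - exact: le_refl.
  - exact: le_refl.
  - by exists (swap_locs z); [case: z nz => [[]|]|apply: swap_locsK].
move=> u _ _; apply: bindC; apply/hasPn => v.
rewrite !inE; move: na nb; rewrite !inE !negb_or.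
case: v => // v; rewrite !(inj_eq (_ : injective Chan)); try by move=> ? ? [].
by move=> /andP[ac ad] /andP[bc bd] /orP[] /eqP ->; rewrite ![_ == a]eq_sym ![_ == b]eq_sym
  ?(negbTE ac) ?(negbTE ad) ?(negbTE bc) ?(negbTE bd).
Qed.

Lemma scong_ax_ty P Q : scong_ax P Q -> is_proc P ->
  forall (A : eqType) (r : ident -> A) G D, ty P r G D <-> ty Q r G D.
Proof.
case=> {P Q}.
- by move=> P _ A r G D; apply: ty_nil_par.
- by move=> P Q _ A r G D; split; apply: ty_parC.
- by move=> P Q O _ A r G D; apply: ty_parA.
- by move=> P Q _ A r G D /=; tauto.
- by move=> P Q O _ A r G D /=; tauto.
- move=> a b /= /andP[/eqP ab _] A r G D; split=> /=.
    by move=> [_ [T [S [_ h]]]] z; apply: (h (inl z)).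
  move=> h; split=> //; exists TEnd, TEnd; split.
    exact: compat_end isend_TEnd isend_TEnd.
  by case=> [z|[|[|i]]] //=; rewrite ?nth_nil; apply: isend_TEnd.
- by move=> a b P Q na nb _ A r G D; apply: ty_res_par.
- move=> a b c d P na nb _ A r G D; split; first exact: ty_res_res.
  move: na nb; rewrite !inE !negb_or => /andP[ac ad] /andP[bc bd].
  by apply: ty_res_res; rewrite !inE !negb_or [_ == a]eq_sym [_ == b]eq_sym ?ac ?ad ?bc ?bd.
- move=> X xs P _ A r G D /=; split; last by right.
  by case=> [[Ts []]|].
- move=> X xs P a b Q na nb _ A r G D /=; split.
    case=> [[Ts [u sz tP [ab [T [S [c tQ]]]]]]|[ab [T [S [c tQ]]]]];
      split=> //; exists T, S; split=> //; [left; exists Ts|right]; by [|split].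
  case=> [ab [T [S [c [[Ts [u sz tP tQ]]|tQ]]]]]; [left; exists Ts|right].
    by split=> //; split=> //; exists T, S.
  by split=> //; exists T, S.
- move=> X xs P Q O nX _ A r G D /=; split.
    case=> s [[[Ts [u sz tP tQ]]|tQ] tO]; [left; exists Ts; split=> //|right];
      by exists s; split=> //; apply/(ty_pupd _ _ _ _ nX).
  case=> [[Ts [u sz tP [s [tQ tO]]]]|[s [tQ tO]]]; exists s; split.
  + by left; exists Ts.
  + by move/(ty_pupd _ _ _ _ nX): tO.
  + by right.
  + by move/(ty_pupd _ _ _ _ nX): tO.
- move=> X xs P Y ys Q O ne nQ nP _ A r G D; split; apply: ty_def_def => //.
  by rewrite eq_sym.
Qed.

Lemma congruence_ty (R : proc -> proc -> Prop) P Q :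
  (forall P Q, R P Q ->
     forall (A : eqType) (r : ident -> A) G D, ty P r G D <-> ty Q r G D) ->
  congruence R P Q ->
  forall (A : eqType) (r : ident -> A) G D, ty P r G D <-> ty Q r G D.
Proof.
move=> hR; elim=> {P Q}.
- exact: hR.
- by [].
- by move=> P Q _ IH A r G D; rewrite IH.
- by move=> P Q O _ IH1 _ IH2 A r G D; rewrite IH1.
- by move=> u bs l x P Q cs _ IH A r G D; split; apply: ty_inp_congr => D' /IH.
- move=> u l v P Q _ IH A r G D /=.
  by split=> [] [cs [S [T [uf lk h]]]]; exists cs, S, T; split=> //;
    (case: h => [[eS tP]|[nS ne leS tP]]; [left|right]; split=> //); apply/IH.
- move=> P P' Q Q' _ IH1 _ IH2 A r G D /=.
  by split=> [] [k [tP tQ]]; exists k; split; [apply/IH1|apply/IH2|apply/IH1|apply/IH2].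
- by move=> P P' Q Q' _ IH1 _ IH2 A r G D /=; rewrite IH1 IH2.
- move=> X xs P P' Q Q' _ IH1 _ IH2 A r G D /=.
  by split=> [] [[Ts [u sz tP tQ]]|tQ]; [left; exists Ts|right|left; exists Ts|right];
    (split || idtac) => //; (apply/IH1 || apply/IH2).
- move=> a b P Q _ IH A r G D /=.
  by split=> [] [ab [T [S [c tP]]]]; split=> //; exists T, S; split=> //; apply/IH.
Qed.

Lemma scong_ty P Q : scong P Q ->
  forall (A : eqType) (r : ident -> A) G D, ty P r G D <-> ty Q r G D.
Proof.
apply: congruence_ty => {}P {}Q [[h|h] pP _]; first exact: alpha_ty.
exact: scong_ax_ty.
Qed.

(** * Subject reduction *)

Lemma keep_bra (A : Type) (s : A -> bool) D z bs :
  unfolds (keep s D z) (TBra bs) -> s z /\ unfolds (D z) (TBra bs).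
Proof. by rewrite /keep; case: (s z) => // /bra_end /(_ isend_TEnd). Qed.

Lemma keep_sel (A : Type) (s : A -> bool) D z bs :
  unfolds (keep s D z) (TSel bs) -> s z /\ unfolds (D z) (TSel bs).
Proof. by rewrite /keep; case: (s z) => // /sel_end /(_ isend_TEnd). Qed.

Lemma bind_res_l (A : Type) (r : ident -> A) a b :
  bind [:: Chan a; Chan b] r (Chan a) = inr 0.
Proof. by rewrite /bind !inE eqxx /= eqxx. Qed.

Lemma bind_res_r (A : Type) (r : ident -> A) a b :
  a <> b -> bind [:: Chan a; Chan b] r (Chan b) = inr 1.
Proof. by move=> ab; rewrite /bind !inE eqxx orbT /= eqxx; case: eqP => // -[]. Qed.

Lemma compat_sel_bra T S bs cs l T1 T2 :
  compat T S -> unfolds T (TSel bs) -> unfolds S (TBra cs) ->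
  lookup l bs = Some (T1, T2) ->
  exists S1 S2, [/\ lookup l cs = Some (S1, S2), le S1 T1 & compat T2 S2].
Proof.
move=> /compatE[[e _]|[bs' [cs' [u _ _]]]|[bs' [cs' [u v h]]]] uT uS.
- by case: (sel_end uT e).
- by case: (bra_sel u uT).
- by rewrite (sel_inv uT u) (bra_inv uS v); apply: h.
Qed.

Lemma embeds_unbind_end (A : Type) (d : A) D S : isend S ->
  embeds (unbind d) (benv D [:: S]) D.
Proof.
move=> eS.
have e i : isend (nth TEnd [:: S] i) by case: i => [|i] //=; rewrite nth_nil; apply: isend_TEnd.
split=> [[z|i]|[z|i] [z'|i']|z nz] //=.
- by move=> _; apply: le_refl.
- by move=> _ _ ->.
- by exists (inl z).
Qed.

Lemma embeds_unbind (A : eqType) (d : A) D D' S :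
  ~ isend S -> isend (D d) -> le S (D' d) -> (forall z, z != d -> D' z = D z) ->
  embeds (unbind d) (benv D [:: S]) D'.
Proof.
move=> nS eD leS eq.
have i0 i : ~ isend (nth TEnd [:: S] i) -> i = 0.
  by case: i => //= i []; rewrite nth_nil; apply: isend_TEnd.
have nd z : ~ isend (D z) -> z != d by move=> nz; apply/eqP => e; rewrite e in nz.
split=> [[z|i]|[z|i] [z'|i']|z] /=.
- by move=> nz; rewrite eq ?nd //; apply: le_refl.
- by move/i0 => ->.
- by move=> _ _ ->.
- by move=> nz _ e; move: (nd _ nz); rewrite e eqxx.
- by move=> _ nz e; move: (nd _ nz); rewrite e eqxx.
- by move=> /i0 -> /i0 ->.
- case: (z =P d) => [-> _|/eqP ne]; first by exists (inr 0).
  by rewrite eq // => nz; exists (inl z).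
Qed.

Lemma ty_com a b l c P bs x Q (A : eqType) (r : ident -> A) G D :
  lookup l bs = Some (x, Q) -> c \notin bc Q ->
  ty (Res a b (Par (Out (Chan a) l (Chan c) P) (Inp (Chan b) bs))) r G D ->
  ty (Res a b (Par P (subst (repl [:: Var x] [:: Chan c]) Q))) r G D.
Proof.
move=> lkQ nc [ab [T [S [cTS [s [tO tI]]]]]].
case: tO tI => [ds [U [V [ufT lk alt]]]] [es [ufS _ _ tbs]].
move: ufT ufS alt tbs; set rho := bind [:: Chan a; Chan b] r.
rewrite (bind_res_l r a b : rho (Chan a) = inr 0) (bind_res_r r ab : rho (Chan b) = inr 1); set E := benv D [:: T; S] => uf uf' alt tbs.
have [s0 ufT] := keep_sel uf; have [s1 ufS] := keep_bra uf'.
move: s1 => /= /negbTE s1.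
have [S1 [T1 [lk1 leS1 cV]]] := compat_sel_bra cTS ufT ufS lk.
have [S' [T' [/= leST tQ]]] := every_lookup tbs lkQ.
have [leS' leT'] := leST _ _ lk1; have leSU := le_trans leS' leS1.
have nocap : no_capture (bids Q) (repl [:: Var x] [:: Chan c]).
  by move=> u; rewrite repl1E; case: eqP => // _ /bids_bc; rewrite (negbTE nc).
have subQ R : embeds (unbind (rho (Chan c)))
    (benv (upd (keep (negb \o s) E) (inr 1) T') [:: S']) R ->
    ty (subst (repl [:: Var x] [:: Chan c]) Q) rho G R.
  move=> emb; apply/(ty_subst _ _ _ nocap); apply: (ty_map tQ emb) => // u _ _.
  by rewrite /bind inE /= repl1E; case: eqP.
split=> //; exists V, T'; split; first exact: compat_le cV leT'.
case: alt => [[eU tP]|[nU ne leU tP]].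
  exists s; split.
    apply: ty_eqD tP _ => -[z|[|[|i]]]; rewrite /upd /keep //=.
      by rewrite s0.
    by rewrite s1.
  have eS' : isend S' by apply/(le_isend leSU).
  apply: (ty_eqD (D := upd (keep (negb \o s) E) (inr 1) T')).
    exact: subQ (embeds_unbind_end _ _ eS').
  move=> [z|[|[|i]]]; rewrite /upd /keep //=; first by rewrite s0.
  by rewrite s1.
have nS' : ~ isend S' by move/(le_isend leSU).
move: leU subQ ne tP; set d := rho (Chan c) => leU subQ /eqP d0 tP.
have [sd _] := keep_not_end (le_not_end leU nU).
have d1 : d != inr 1 by apply/eqP => e; rewrite -e sd in s1.
have Ed : benv D [:: V; T'] d = E d.
  by move: d0 d1; rewrite /E; case: (d) => [|[|[|]]].
rewrite /keep sd in leU.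
exists (fun z => s z && (z != d)); split.
  apply: ty_eqD tP _ => z; rewrite /upd /keep; case: (z =P d) => [_|_].
    by rewrite andbF.
  rewrite andbT; case: z => [z|[|[|i]]] //=; first by rewrite s0.
  by rewrite s1.
apply: subQ; apply: embeds_unbind => //.
- by rewrite /upd (negbTE d1) /keep /= sd; apply: isend_TEnd.
- by rewrite /keep /= sd eqxx Ed; apply: le_trans leU.
move=> z zd; rewrite /keep /upd /= zd andbT.
by case: z zd => [z|[|[|i]]] _ //=; rewrite ?s0 ?s1.
Qed.

Lemma ty_call X xs P cs Q (A : eqType) (r : ident -> A) G D :
  all (fun c => c \notin bc P) cs -> size cs = size xs ->
  ty (Def X xs P (Par (Call X (map Chan cs)) Q)) r G D ->
  ty (Def X xs P (Par (subst (repl (map Var xs) (map Chan cs)) P) Q)) r G D.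
Proof.
move=> ncs scs /= [[Ts [uxs sz tP [s [[Us [GX sU emb]] tQ]]]]|[s [[Us [GX _ _]] _]]]; last first.
  by move: GX; rewrite /pupd eqxx.
move: GX emb; rewrite /pupd eqxx => -[<-] emb.
left; exists Ts; split=> //; exists s; split=> //.
have replE u : u \notin map Var xs -> repl (map Var xs) (map Chan cs) u = u.
  by rewrite -index_mem -leqNgt => h; rewrite /repl nth_default // size_map scs -(size_map Var).
apply/ty_subst.
  move=> u; case: (boolP (u \in map Var xs)) => [ux|/replE //].
  have : repl (map Var xs) (map Chan cs) u \in map Chan cs.
    by rewrite mem_nth // size_map scs -(size_map Var) index_mem.
  by case/mapP=> c /(allP ncs) nc -> /bids_bc; rewrite (negbTE nc).
apply: (ty_map tP emb) => // u _ /nth_not_end; rewrite -sz -scs => lt_u.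
rewrite /pvar_fun /repl /=; congr r; apply: set_nth_default.
by rewrite size_map.
Qed.

Lemma ty_fill P P' C (A : eqType) (r : ident -> A) G D :
  (forall (A : eqType) (r : ident -> A) G D, ty P r G D -> ty P' r G D) ->
  ty (fill C P) r G D -> ty (fill C P') r G D.
Proof.
move=> h; elim: C A r G D => [|C IH Q|a b C IH|X xs Q C IH] A r G D /=.
- exact: h.
- by case=> s [tP tQ]; exists s; split=> //; apply: IH.
- by case=> ab [T [S [c tP]]]; split=> //; exists T, S; split=> //; apply: IH.
- case=> [[Ts [u sz tQ tC]]|tC]; last by right; apply: IH.
  by left; exists Ts; split=> //; apply: IH.
Qed.

Lemma red_ty P Q : red P Q ->
  forall (A : eqType) (r : ident -> A) G D, ty P r G D -> ty Q r G D.
Proof.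
elim=> {P Q}.
- by move=> a b l c P bs x Q lk nc A r G D; apply: ty_com.
- by move=> X xs P cs Q sz nc A r G D; apply: ty_call.
- by move=> P Q A r G D [].
- by move=> C P P' _ IH A r G D; apply: ty_fill.
- move=> P P' Q' Q PP _ IH QQ A r G D /(scong_ty PP) /IH.
  by move/(scong_ty QQ).
- move=> a b l c P bs lk A r G D [ab [T [S [cTS [s [tO tI]]]]]].
  case: tO tI => [ds [U [V [ufT lkU _]]]] [es [ufS _ h _]]; move: ufT ufS.
  rewrite bind_res_l (bind_res_r r ab) => ufT ufS.
  have [_ uT] := keep_sel ufT; have [_ uS] := keep_bra ufS.
  have [S1 [T1 [lk1 _ _]]] := compat_sel_bra cTS uT uS lkU.
  by case: (h l _ lk); rewrite lk1.
- move=> a b P aP bP A r G D [ab [T [S [cTS tP]]]].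
  have := ty_subject aP tP; rewrite {1}/bind inE eqxx /= eqxx => /= nT.
  have nS : ~ isend S by move/(compat_end_iff cTS).
  have [|u uP] := ty_used (z := inr 1) tP; first exact: nS.
  rewrite /bind !inE; case: (u =P Chan b) => [e _|nb].
    by move: uP; rewrite e => /fid_fc; rewrite (negbTE bP).
  by case: (u =P Chan a) => [->|_] //=; rewrite eqxx.
- move=> a b l c P l' c' Q A r G D [ab [T [S [cTS [s [tO tI]]]]]].
  case: tO tI => [ds [U [V [ufT _ _]]]] [es [_ [_ [ufS _ _]]]]; move: ufT ufS.
  rewrite bind_res_l (bind_res_r r ab) => ufT ufS.
  have [_ uT] := keep_sel ufT; have [_ uS] := keep_sel ufS.
  case: (compatE cTS) => [[e _]|[? [? [u _ _]]]|[? [? [_ v _]]]].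
  + exact: (sel_end uT e).
  + exact: (bra_sel u uT).
  + exact: (bra_sel v uS).
- move=> a b bs cs A r G D [ab [T [S [cTS [s [tO tI]]]]]].
  case: tO tI => [ds [ufT _ _ _]] [es [ufS _ _ _]]; move: ufT ufS.
  rewrite bind_res_l (bind_res_r r ab) => ufT ufS.
  have [_ uT] := keep_bra ufT; have [_ uS] := keep_bra ufS.
  case: (compatE cTS) => [[e _]|[? [? [_ v _]]]|[? [? [u _ _]]]].
  + exact: (bra_end uT e).
  + exact: (bra_sel uS v).
  + exact: (bra_sel uT u).
- by elim=> [|C IH Q|a b C IH|X xs Q C IH] A r G D //= => [[s [/IH]]|[_ [? [? [_ /IH]]]]|[[? [_ _ _ /IH]]|/IH]].
Qed.

Lemma reds_ty P Q : reds P Q ->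
  forall (A : eqType) (r : ident -> A) G D, ty P r G D -> ty Q r G D.
Proof.
elim=> {P Q} [P Q|//|P Q O _ IH1 _ IH2] A; first exact: red_ty.
by move=> r G D /IH1 /IH2.
Qed.

(** * From the typing rules to locations *)

Fixpoint sane (P : proc) : bool :=
  match P with
  | Nil | Call _ _ | Err => true
  | Inp _ bs => [&& 0 < size bs, uniq (unzip1 bs) & all (fun b => sane b.2.2) bs]
  | Out _ _ _ P | Res _ _ P => sane P
  | Par P Q | Plus P Q | Def _ _ P Q => sane P && sane Q
  end.

Lemma every_all (A : Type) (p q : pred A) s :
  every (fun x => p x -> q x) s -> all p s -> all q s.
Proof. by elim: s => //= x s IH [pq /IH{}IH] /andP[/pq -> /IH]. Qed.

Lemma every_all_eq (A B : Type) (f : A -> B) (p : pred A) (q : pred B) s :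
  every (fun x => q (f x) = p x) s -> all q (map f s) = all p s.
Proof. by elim: s => //= x s IH [-> /IH ->]. Qed.

Lemma is_proc_sane P : is_proc P -> sane P.
Proof.
elim/proc_nested_ind: P => //= [u bs IH|P Q IHP IHQ|P Q IHP IHQ|X xs P Q IHP IHQ|a b P IH].
- by case/and3P=> -> -> /(every_all IH).
- by case/andP=> /IHP -> /IHQ.
- by case/andP=> /IHP -> /IHQ.
- by case/and4P=> _ _ /IHP -> /IHQ.
- by case/andP.
Qed.

Lemma sane_subst P s : sane (subst s P) = sane P.
Proof.
elim/proc_nested_ind: P s => //= [u bs IH|P Q IHP IHQ|P Q IHP IHQ|X xs P Q IHP IHQ] s.
- rewrite (unzip1_map (fun c => (c.1, subst (mask [:: Var c.1] s) c.2))) size_map.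
  by congr [&& _, _ & _]; apply: every_all_eq; apply: every_impl IH => b h /=; rewrite h.
- by rewrite IHP IHQ.
- by rewrite IHP IHQ.
- by rewrite IHP IHQ.
Qed.

Lemma sane_prename P X Y : sane (prename X Y P) = sane P.
Proof.
elim/proc_nested_ind: P => //= [u bs IH|P Q IHP IHQ|P Q IHP IHQ|Z xs P Q IHP IHQ].
- rewrite (unzip1_map (fun c => (c.1, prename X Y c.2))) size_map.
  by congr [&& _, _ & _]; apply: every_all_eq.
- by rewrite IHP IHQ.
- by rewrite IHP IHQ.
- by case: eqP => //= _; rewrite IHP IHQ.
Qed.

Lemma sane_inp u bs l x y P Q cs : sane P = sane Q ->
  sane (Inp u (bs ++ (l, (x, P)) :: cs)) = sane (Inp u (bs ++ (l, (y, Q)) :: cs)).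
Proof. by move=> /= e; rewrite !size_cat /unzip1 !map_cat !all_cat /= e. Qed.

Lemma sane_alpha P Q : alpha P Q -> sane P = sane Q.
Proof.
elim=> {P Q} //=.
- move=> P Q [] {P Q} *; try by rewrite /= ?sane_subst ?sane_prename.
  by apply: sane_inp; rewrite sane_subst.
- by move=> P Q O _ -> _ ->.
- by move=> u bs l x P Q cs _; apply: sane_inp.
- by move=> P P' Q Q' _ -> _ ->.
- by move=> P P' Q Q' _ -> _ ->.
- by move=> X xs P P' Q Q' _ -> _ ->.
Qed.

Lemma alpha_cong_ty P Q : alpha P Q ->
  forall (A : eqType) (r : ident -> A) G D, ty P r G D <-> ty Q r G D.
Proof. by apply: congruence_ty => {}P {}Q; apply: alpha_ty. Qed.

Local Open Scope fset_scope.
Local Open Scope fmap_scope.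

Definition genv (G : shenv) : penv := fun X => G.[? X].

Definition denv (D : senv) (u : ident) : typ := odflt TEnd D.[? u].

Lemma fnd_domf (D : senv) u T : D.[? u] = Some T -> u \in domf D.
Proof. by move=> e; apply: contraPT e => /not_fnd ->. Qed.

Lemma denv_set (D : senv) u T : denv D.[u <- T] =1 upd (denv D) u T.
Proof. by move=> v; rewrite /denv /upd fnd_set; case: eqP. Qed.

Lemma denv_notin (D : senv) u : u \notin domf D -> denv D u = TEnd.
Proof. by rewrite /denv => /not_fnd ->. Qed.

Lemma genv_set (G : shenv) X Ts : genv G.[X <- Ts] = pupd (genv G) X (Some Ts).
Proof.
by apply: functional_extensionality => Y; rewrite /genv /pupd fnd_set.
Qed.

Lemma denv_senv_of us Ts u : size us = size Ts ->
  denv (senv_of us Ts) u = nth TEnd Ts (index u us).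
Proof.
elim: us Ts => [|v us IH] [|T Ts] //=; first by rewrite /denv fnd_fmap0.
by move=> [sz]; rewrite denv_set /upd eq_sym; case: eqP => //= _; apply: IH.
Qed.

Lemma wf_senv_set (D : senv) u T : wf_senv D -> stype T -> wf_senv D.[u <- T].
Proof.
move=> wD sT v S; rewrite fnd_set; case: eqP => [_ [<-]//|_]; exact: wD.
Qed.

Lemma wf_senv_of us Ts : all stype Ts -> wf_senv (senv_of us Ts).
Proof.
elim: us Ts => [|u us IH] [|T Ts] //= h; try by move=> v S; rewrite fnd_fmap0.
by case/andP: h => sT sTs; apply: wf_senv_set => //; apply: IH.
Qed.

Lemma embeds_bind us D D' Ts : uniq us -> size us = size Ts ->
  (forall u, u \in us -> isend (D u)) -> (forall u, u \notin us -> D' u = D u) ->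
  (forall u, u \in us -> D' u = nth TEnd Ts (index u us)) ->
  embeds (bind us id) D' (benv D Ts).
Proof.
move=> uus sz eD Dn Di; rewrite /bind; split=> [u|u v|[u|i]] /=.
- case: ifP => [/Di ->|/negbT/Dn ->] _; exact: le_refl.
- case: ifP => [ui|_]; case: ifP => [vi|_] // _ _ [] //.
  by move=> e; rewrite -(nth_index u ui) e nth_index.
- move=> nu; have : u \notin us by apply/negP => /eD.
  by move=> h; exists u; rewrite ?Dn // (negbTE h).
- move=> ni; have lt_i : i < size us by rewrite sz; apply: nth_not_end.
  exists (nth (Chan 0) us i); rewrite ?mem_nth // ?index_uniq //.
  by rewrite Di ?mem_nth // index_uniq.
Qed.

Lemma ty_bind P us (D' : senv) (D0 : ident -> typ) Ts G : uniq us -> size us = size Ts ->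
  ty P id G (denv D') -> (forall u, u \in us -> isend (D0 u)) ->
  (forall u, u \notin us -> denv D' u = D0 u) ->
  (forall u, u \in us -> denv D' u = nth TEnd Ts (index u us)) ->
  ty P (bind us id) G (benv D0 Ts).
Proof.
move=> uus sz tP h0 h1 h2; apply: (ty_map tP (embeds_bind uus sz h0 h1 h2)) => //.
Qed.

Lemma typing_ty G P D : typing G P D -> sane P ->
  (forall X Ts, G.[? X] = Some Ts -> all stype Ts) ->
  wf_senv D /\ ty P id (genv G) (denv D).
Proof.
elim=> {G P D}.
- move=> G P D D' _ IH DD wD' sP wG; split=> //.
  have [_ tP] := IH sP wG; apply: ty_sub tP _ => u; have := DD u; rewrite /denv.
  case: (D.[? u]) => [T|]; case: (D'.[? u]) => [T'|] //=.
  + exact: subtype_le.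
  + exact: tree_eq_le.
  + by move/tree_eq_sym/tree_eq_le.
  + by move=> _; apply: le_refl.
- move=> G P D D' _ IH DD wD' sP wG; split=> //.
  have [_ tP] := IH sP wG; apply: ty_sub tP _ => u; have := DD u; rewrite /denv.
  case: (D.[? u]) => [T|]; case: (D'.[? u]) => [T'|] //=.
  + exact: tree_eq_le.
  + by move=> _; apply: le_refl.
- move=> G P P' D _ IH al sP wG; have [wD tP] := IH (etrans (sane_alpha al) sP) wG.
  by split=> //; apply/(alpha_cong_ty al).
- move=> G _ _; split=> [u T|u]; first by rewrite fnd_fmap0.
  by rewrite /denv fnd_fmap0; apply: isend_TEnd.
- move=> G X us Ts GX uus sz _ wG; split; first exact: wf_senv_of (wG _ _ GX).
  exists Ts; split=> //; split=> [i /nth_not_end lt_i|i j /nth_not_end lt_i /nth_not_end lt_j|u].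
  + rewrite /pvar_fun /= denv_senv_of // index_uniq ?sz //; exact: le_refl.
  + by rewrite /pvar_fun /= => /eqP; rewrite nth_uniq ?sz // => /eqP.
  + rewrite denv_senv_of // => n; exists (index u us) => //.
    by rewrite /pvar_fun /= nth_index // -index_mem sz; apply: nth_not_end.
- move=> G u bs D cs ubs nu hx _ IH /= /and3P[sz ulab sP] wG.
  have [sbs IHb] : (forall l b, lookup l bs = Some b -> sane b.2) /\
     (forall l x P S T, lookup l bs = Some (x, P) -> lookup l cs = Some (S, T) ->
       wf_senv D.[u <- T].[Var x <- S] /\ ty P id (genv G) (denv D.[u <- T].[Var x <- S])).
    suff h : forall l b, lookup l bs = Some b -> sane b.2.
      by split=> // l x P S T e e'; apply: (IH l x P S T e e') => //; apply: (h l _ e).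
    move=> l b; elim: (bs) sP => //= -[k c] bs' IHbs /andP[sc sbs'].
    by case: eqP => [_ [<-]|_]; [|apply: IHbs].
  have csE l b : lookup l bs = Some b -> exists S T, lookup l cs = Some (S, T).
    move=> e; have [|[S T] e'] := @lookup_eqi _ _ bs cs l b _ e; first by rewrite ubs.
    by exists S, T.
  have bsE l c : lookup l cs = Some c -> exists x P, lookup l bs = Some (x, P).
    move=> e; have [|[x P] e'] := @lookup_eqi _ _ cs bs l c _ e; first by rewrite ubs.
    by exists x, P.
  have wD v S : v != u -> D.[? v] = Some S -> stype S.
    move=> vu e; case: (bs) sz csE IHb hx => // -[l [x P]] bs' _ csE IHb hx.
    have e0 : lookup l ((l, (x, P)) :: bs') = Some (x, P) by rewrite /= eqxx.
    have [U [T e']] := csE _ _ e0; have [wD _] := IHb _ _ _ _ _ e0 e'.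
    have [nx _] := hx _ _ _ e0.
    apply: (wD v); rewrite !fnd_set (negbTE vu); case: eqP => // vx.
    by move: nx; rewrite -vx; case/negP; apply: fnd_domf e.
  have wcs : stype (TBra cs).
    apply: lookup_stype; first by rewrite -ubs.
    move=> l S T e; have [x [P e']] := bsE _ _ e; have [w _] := IHb _ _ _ _ _ e' e.
    have [_ xu] := hx _ _ _ e'.
    split; first by apply: (w (Var x)); rewrite fnd_set eqxx.
    by apply: (w u); rewrite !fnd_set eq_sym (negbTE xu) eqxx.
  split.
    move=> v S; rewrite fnd_set; case: eqP => [_ [<-] //|/eqP vu]; exact: wD.
  exists cs; split.
  + by rewrite denv_set /upd eqxx; apply: unfolds_refl.
  + by case: (bs) sz.
  + by move=> l; case e: (lookup l cs) => [c|] // _; have [x [P ->]] := bsE _ _ e.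
  apply: lookup_every => // l [x P] e; have [S [T e']] := csE _ _ e.
  exists S, T; split=> /=.
    by rewrite e' => S' T' [<- <-]; split; apply: le_refl.
  have [_ tP] := IHb _ _ _ _ _ e e'; have [nx xu] := hx _ _ _ e.
  apply: ty_bind tP _ _ _ => // v.
  + rewrite inE => /eqP ->; rewrite /upd denv_set /upd (negbTE xu) (denv_notin nx).
    exact: isend_TEnd.
  + by rewrite inE => vx; rewrite !denv_set /upd (negbTE vx) !denv_set /upd; case: eqP.
  + by rewrite inE => /eqP ->; rewrite denv_set /upd eqxx /= eqxx.
- move=> G u l v P D S T nu nv uv sS _ IH /= sP wG; have [w tP] := IH sP wG.
  have sT : stype T by apply: (w u); rewrite fnd_set eqxx.
  have wD : wf_senv D.
    move=> z U e; apply: (w z); rewrite fnd_set; case: eqP => // zu.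
    by move: nu; rewrite -zu; case/negP; apply: fnd_domf e.
  split.
    do 2!(apply: wf_senv_set => //).
    rewrite stype_sel; apply: lookup_stype => // k S' T' /=; case: eqP => // _ [<- <-]; by [].
  exists [:: (l, (S, T))], S, T; split.
  + rewrite denv_set /upd (negbTE uv) denv_set /upd eqxx; exact: unfolds_refl.
  + by rewrite /= eqxx.
  have vu : v != u by rewrite eq_sym.
  case: (classic (isend S)) => [eS|nS]; [left|right].
    split=> //; apply: ty_sub tP _ => z; rewrite denv_set /upd.
    case: eqP => [_|/eqP zu]; first exact: le_refl.
    rewrite denv_set /upd denv_set /upd (negbTE zu).
    case: eqP => [->|_]; last exact: le_refl.
    by rewrite denv_notin //; apply: le_end => //; apply: isend_TEnd.
  split=> //; first exact/eqP.
    by rewrite denv_set /upd eqxx; apply: le_refl.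
  apply: ty_eqD tP _ => z; rewrite denv_set /upd.
  case: (z =P v) => [->|/eqP zv]; first by rewrite (negbTE vu) denv_notin.
  by case: eqP => // /eqP zu; rewrite !denv_set /upd (negbTE zv) denv_set /upd (negbTE zu).
- move=> G P1 P2 D1 D2 dis _ IH1 _ IH2 /= /andP[s1 s2] wG.
  have [w1 t1] := IH1 s1 wG; have [w2 t2] := IH2 s2 wG; split.
    by move=> u T; rewrite fnd_cat; case: ifP => _; [apply: w2|apply: w1].
  exists (fun u => u \notin domf D2); split.
    apply: ty_eqD t1 _ => u; rewrite /keep /denv fnd_cat; case: ifP => [/negbTE -> //|].
    move/negbFE => u2; rewrite not_fnd //; apply: contraL u2.
    by move/fdisjointP: dis; apply.
  apply: ty_eqD t2 _ => u; rewrite /keep /denv fnd_cat /= negbK.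
  by case: (boolP (u \in domf D2)) => // /not_fnd ->.
- move=> G P1 P2 D _ IH1 _ IH2 /= /andP[s1 s2] wG.
  by have [w1 t1] := IH1 s1 wG; have [w2 t2] := IH2 s2 wG.
- move=> G X xs Ts P Q D nX uxs sz wTs _ IHP _ IHQ /= /andP[sP sQ] wG.
  have wG' Y Us : G.[X <- Ts].[? Y] = Some Us -> all stype Us.
    by rewrite fnd_set; case: eqP => [_ [<-]//|_]; apply: wG.
  have [_ tP] := IHP sP wG'; have [wD tQ] := IHQ sQ wG'; split=> //.
  rewrite genv_set in tP tQ; left; exists Ts; split=> //.
  have sz' : size (map Var xs) = size Ts by rewrite size_map.
  have uxs' : uniq (map Var xs) by rewrite map_inj_uniq // => ? ? [].
  apply: (ty_map (f := fun u => index u (map Var xs)) tP) => //.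
  split=> [u _|u v|i ni].
  + by rewrite denv_senv_of //; apply: le_refl.
  + rewrite !denv_senv_of // => /nth_not_end; rewrite -sz' index_mem => ux.
    move=> /nth_not_end; rewrite -sz' index_mem => vx e.
    by rewrite -(nth_index u ux) e nth_index.
  + have lt_i : i < size (map Var xs) by rewrite sz'; apply: nth_not_end.
    exists (nth (Chan 0) (map Var xs) i); last exact: index_uniq.
    by rewrite denv_senv_of // index_uniq.
- move=> G a b P D T ab na nb _ IH /= sP wG; have [w tP] := IH sP wG.
  have cab : Chan a != Chan b by apply: contra ab => /eqP[->].
  split.
    move=> u U e; apply: (w u); rewrite !fnd_set.
    have uD : u \in domf D by apply: fnd_domf e.
    case: eqP => [ub|_]; first by rewrite -ub uD in nb.
    by case: eqP => [ua|_] //; rewrite -ua uD in na.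
  split; first exact/eqP.
  exists T, (dual T); split.
    apply: compat_dual; apply: (w (Chan a)).
    by rewrite !fnd_set (negbTE cab) eqxx.
  apply: ty_bind tP _ _ _ => //= [|u|u|u].
  + by rewrite inE cab.
  + by rewrite !inE => /orP[] /eqP ->; rewrite denv_notin //; apply: isend_TEnd.
  + by rewrite !inE negb_or => /andP[ua ub]; rewrite !denv_set /upd (negbTE ub) denv_set /upd (negbTE ua).
  + rewrite !inE => /orP[] /eqP ->; rewrite denv_set /upd; last first.
      by rewrite ?eqxx /= (negbTE cab) ?eqxx.
    by rewrite (negbTE cab) denv_set /upd !eqxx.
Qed.

Lemma sane_fill C P P' : sane P' -> is_proc (fill C P) -> sane (fill C P').
Proof.
move=> sP'; elim: C => [|C IH Q|a b C IH|X xs Q C IH] //=.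
- by case/andP=> /IH -> /is_proc_sane ->.
- by case/andP=> _ /IH.
- by case/and4P=> _ _ /is_proc_sane -> /IH.
Qed.

Lemma ty_fill_call P X us Ts C (A : eqType) (r : ident -> A) G D :
  X \notin ectx_pvs C -> G X = Some Ts ->
  (forall (A : eqType) (r : ident -> A) G D,
     G X = Some Ts -> ty (Call X us) r G D -> ty P r G D) ->
  ty (fill C (Call X us)) r G D -> ty (fill C P) r G D.
Proof.
move=> nX GX h; elim: C A r G D nX GX => [|C IH Q|a b C IH|Y xs Q C IH] A r G D;
  rewrite /ectx_pvs /= => nX GX.
- exact: h.
- case=> s [tP tQ]; exists s; split=> //; apply: IH => //.
  by apply: contra nX; rewrite mem_cat => ->.
- by case=> ab [T [S [c tP]]]; split=> //; exists T, S; split=> //; apply: IH.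
- move: nX; rewrite inE mem_cat !negb_or => /and3P[XY _ nX].
  have GX' o : pupd G Y o X = Some Ts by rewrite /pupd (negbTE XY).
  case=> [[Us [u sz tQ tC]]|tC]; last by right; apply: IH.
  by left; exists Us; split=> //; apply: IH.
Qed.

Theorem theorem2p4 (T S : typ) (hT : stype T) (hS : stype S)
    (hTS : subtype T S) (a : nat) :
  ~ exists (C : ectx) (P : proc),
      [/\ is_ectx C, is_proc P, ectx_typing C a S,
          typing fmap0 P fmap0.[Chan a <- T] & reds (fill C P) Err].
Proof.
case=> C [P [pC pP [X nX tC] tP /reds_ty red]].
have [|X' Ts|_ {}tC] := typing_ty tC; first exact: sane_fill pC.
  by rewrite fnd_set fnd_fmap0; case: eqP => // _ [<-] /=; rewrite hS.
have [|X' Ts|_ {}tP] := typing_ty tP; [exact: is_proc_sane|by rewrite fnd_fmap0|].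
apply: (red _ _ _ _ (ty_fill_call nX _ _ tC)); first by rewrite /genv fnd_set eqxx.
move=> A r G D GX /= [Ts []]; rewrite GX => -[<-] _ [e1 _ e3].
have denvP u : denv fmap0.[Chan a <- T] u = if u == Chan a then T else TEnd.
  by rewrite denv_set /upd /denv fnd_fmap0.
have na u : ~ isend (denv fmap0.[Chan a <- T] u) -> u = Chan a /\ ~ isend S.
  rewrite denvP; case: eqP => [-> nT|_ []]; last exact: isend_TEnd.
  by split=> //; move/(le_isend (subtype_le hTS)).
apply: (ty_map (f := r) tP) => //; last by move=> Y Us; rewrite /genv fnd_fmap0.
split=> [u /na[-> nS]|u v /na[-> _] /na[-> _] //|z /e3[i]].
- rewrite denvP eqxx; apply: le_trans (subtype_le hTS) _.
  exact: (e1 0 nS).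
- case: i => [|i] /=; last by rewrite nth_nil => -[]; apply: isend_TEnd.
  move=> nS <-; exists (Chan a) => //; rewrite denvP eqxx.
  by move/(le_isend (subtype_le hTS)).
Qed.
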